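(* Let $K$ and $L$ be compact lines, let $\phi:K\to L$ be a continuous increasing surjection, and let $(F_i)_{i\in I}$ be a weak*-null family in $\mathrm{NBV}(L)$. Then $(F_i)_{i\in I}$ extends through $\phi$ if and only if $(F_i)_{i\in I}$ is of type $c_0\ell_1$ over $Q(\phi)$. Moreover, if $(k_i)_{i\in I}$ is a bounded family of nonnegative real numbers and $(F_i)_{i\in I}$ is of type $c_0\ell_1$ over $Q(\phi)$ bounded by $(k_i)_{i\in I}$, then a weak*-null family $(G_i)_{i\in I}$ in $\mathrm{NBV}(K)$ with $\phi_*(G_i)=F_i$ for all $i\in I$ can be chosen with $\Vert G_i\Vert_{\mathrm{BV}}\le\Vert F_i\Vert_{\mathrm{BV}}+2k_i$ for all $i\in I$.
   Context: A compact line is a totally ordered set which is compact (Hausdorff) in its order topology. For a compact line $K$ and $F:K\to\mathbb R$, the total variation $V(F)$ is the supremum over finite sets $t_0<t_1<\dots<t_n$ in $K$ of $\sum_{j=0}^{n-1}|F(t_{j+1})-F(t_j)|$, and $\Vert F\Vert_{\mathrm{BV}}=|F(\min K)|+V(F)$; $\mathrm{NBV}(K)$ is the Banach space of right-continuous $F:K\to\mathbb R$ with $V(F)<\infty$. Each finite signed regular Borel measure $\mu$ on $K$ corresponds to $F_\mu(t)=\mu([\min K,t])$, giving a linear isometric identification of $M(K)=C(K)^*$ with $\mathrm{NBV}(K)$; for $F\in\mathrm{NBV}(K)$, ''the measure associated to $F$'' is the $\mu$ with $F_\mu=F$. For a family $(a_i)_{i\in I}$ of reals, $\lim_{i\in I}a_i=0$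 means $\{i\in I:|a_i|\ge\varepsilon\}$ is finite for every $\varepsilon>0$; $c_0(I)$ is the space of such families. A family $(F_i)_{i\in I}$ in $\mathrm{NBV}(K)$ is weak*-null if $\lim_{i\in I}\int_K f\,d\mu_i=0$ for every $f\in C(K)$, where $\mu_i$ is the measure associated to $F_i$. For a continuous increasing surjection $\phi:K\to L$ between compact lines and any $G:K\to\mathbb R$, define $\phi_*(G):L\to\mathbb R$ by $\phi_*(G)(t)=G(\max\phi^{-1}(t))$; set $Q(\phi)=\{t\in L:\phi^{-1}(t)\text{ has more than one point}\}$. A weak*-null family $(F_i)_{i\in I}$ in $\mathrm{NBV}(L)$ extends through $\phi$ if there is a weak*-null family $(G_i)_{i\in I}$ in $\mathrm{NBV}(K)$ with $\phi_*(G_i)=F_i$ for all $i$ (equivalently, the associated bounded operator $C(L)\to c_0(I)$ has a bounded extension $S:C(K)\to c_0(I)$ with $S(f\circ\phi)=T(f)$). A family $(F_i)_{i\in I}$ of real-valued maps on a set $Q$ is of type $c_0\ell_1$ if one can write $F_i(t)=a_{i,t}+b_{i,t}$ ($i\in I,t\in Q$) with $\lim_{i\in I}a_{i,t}=0$ for every $t\in Q$ and $\sup_{i\in I}\sum_{t\in Q}|b_{i,t}|<\infty$; it is of type $c_0\ell_1$ bounded by a bounded family $(k_i)_{i\in I}$ of nonnegative reals if moreover $\sum_{t\in Q}|b_{i,t}|\le k_i$ for all $i$. A family of maps defined on a larger set is said to have such a property over a subset $S$ if the family of restrictions to $S$ has it. *)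

(* Defs.v *)
From HB Require Import structures.
From mathcomp Require Import all_boot all_order all_algebra.
From mathcomp Require Import all_classical.
From mathcomp Require Import topology_structure order_topology.
Set Implicit Arguments. Unset Strict Implicit. Unset Printing Implicit Defensive.
Import Order.TTheory GRing.Theory Num.Theory.
Local Open Scope classical_set_scope.
Local Open Scope ring_scope.

(* A totally ordered set carrying its order topology, with a chosen point
   (the point is only needed to build the Borel measurable structure). *)
#[short(type="pointedOrderTopologicalType")]
HB.structure Definition PointedOrderTopological d :=
  { T of PointedTopological T & OrderTopological d T }.

From mathcomp Require Import all_reals all_analysis.
Import numFieldNormedType.Exports.

Section defs.
Context {R : realType}.

(* Compact line: nonempty, compact in its order topology (Hausdorff is
   automatic for an order topology). *)
Definition compact_line {d} (K : pointedOrderTopologicalType d) :=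
  compact [set: K] /\ [set: K] !=set0.

Definition Borel {d} (K : pointedOrderTopologicalType d) :=
  g_sigma_algebraType (@open K).

Definition regular_measure {d} {K : pointedOrderTopologicalType d}
  (nu : {finite_measure set (Borel K) -> \bar R}) :=
  forall A : set (Borel K), measurable A ->
    nu A = ereal_sup [set nu C | C in [set C : set K | compact C /\ C `<=` A]]
    /\ nu A = ereal_inf [set nu U | U in [set U : set K | open U /\ A `<=` U]].

Definition varsum {d} {K : orderType d} (F : K -> R) (s : seq K) : R :=
  \sum_(p <- zip s (behead s)) `|F p.2 - F p.1|.

Definition variation {d} {K : orderType d} (F : K -> R) : \bar R :=
  ereal_sup [set (varsum F s)%:E | s in [set s : seq K | sorted (<%O) s]].

Definition bvnorm {d} {K : orderType d} (F : K -> R) : \bar R :=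
  ereal_sup [set ((`|F m|)%:E + variation F)%E
            | m in [set m : K | forall t, (m <= t)%O]].

Definition right_continuous {d} {K : orderType d} (F : K -> R) :=
  forall (t : K) (e : R), 0 < e ->
    (exists u, (t < u)%O /\
       forall s, (t <= s)%O -> (s < u)%O -> `|F s - F t| < e)
    \/ (forall s, (s <= t)%O).

Definition NBV {d} {K : orderType d} (F : K -> R) :=
  right_continuous F /\ (variation F < +oo)%E.

Definition c0lim {I : Type} (a : I -> R) :=
  forall e : R, 0 < e -> finite_set [set i | e <= `|a i|].

Definition associated {d} {K : pointedOrderTopologicalType d}
  (F : K -> R) (mu1 mu2 : {finite_measure set (Borel K) -> \bar R}) :=
  forall t : K, F t = fine (mu1 [set s : K | (s <= t)%O])
                      - fine (mu2 [set s : K | (s <= t)%O]).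

Definition sintegral {d} {K : pointedOrderTopologicalType d}
  (mu1 mu2 : {finite_measure set (Borel K) -> \bar R}) (f : K -> R) : R :=
  fine (\int[mu1]_x (f x)%:E) - fine (\int[mu2]_x (f x)%:E).

(* Weak*-null family in NBV(K): each F_i is in NBV(K), and for the
   (finite signed regular Borel) measures mu_i associated to F_i,
   lim_i int f dmu_i = 0 for every f in C(K). A finite signed regular Borel
   measure is written as the difference of two finite regular measures. *)
Definition wstar_null {d} {K : pointedOrderTopologicalType d} {I : Type}
  (F : I -> K -> R) :=
  (forall i, NBV (F i)) /\
  exists mu1 mu2 : I -> {finite_measure set (Borel K) -> \bar R},
    (forall i, regular_measure (mu1 i) /\ regular_measure (mu2 i)
               /\ associated (F i) (mu1 i) (mu2 i)) /\
    forall f : K -> R, continuous f ->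
      c0lim (fun i => sintegral (mu1 i) (mu2 i) f).

Definition pushes {dK dL} {K : orderType dK} {L : orderType dL}
  (phi : K -> L) (G : K -> R) (F : L -> R) :=
  forall (t : L) (s : K), phi s = t ->
    (forall s', phi s' = t -> (s' <= s)%O) -> F t = G s.

Definition Qset {dK dL} {K : orderType dK} {L : orderType dL} (phi : K -> L)
  : set L :=
  [set t | exists s1 s2, s1 <> s2 /\ phi s1 = t /\ phi s2 = t].

Definition c0l1 {T : choiceType} {I : Type} (Q : set T) (F : I -> T -> R) :=
  exists a b : I -> T -> R,
    (forall i t, Q t -> F i t = a i t + b i t) /\
    (forall t, Q t -> c0lim (fun i => a i t)) /\
    exists M : R, forall i, (\esum_(t in Q) (`|b i t|)%:E <= M%:E)%E.

Definition c0l1_bounded {T : choiceType} {I : Type} (Q : set T)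
  (F : I -> T -> R) (k : I -> R) :=
  exists a b : I -> T -> R,
    (forall i t, Q t -> F i t = a i t + b i t) /\
    (forall t, Q t -> c0lim (fun i => a i t)) /\
    (exists M : R, forall i, (\esum_(t in Q) (`|b i t|)%:E <= M%:E)%E) /\
    forall i, (\esum_(t in Q) (`|b i t|)%:E <= (k i)%:E)%E.

Definition extends_through {dK dL} {K : pointedOrderTopologicalType dK}
  {L : pointedOrderTopologicalType dL} {I : Type}
  (phi : K -> L) (F : I -> L -> R) :=
  exists G : I -> K -> R, wstar_null G /\ forall i, pushes phi (G i) (F i).

End defs.

(* Main.v *)
(* A Riemann-Stieltjes estimate bounds an integral against the measure of [G]
   by the BV norm of [G], and a gliding hump argument bounds the BV norms of a
   weak*-null family uniformly. For [t] in [Q(phi)] write [lo t < hi t] for the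
   ends of the fiber of [t].

   If [G_i] extends [F_i], pick a continuous [f_t] equal to 1 up to [lo t] and
   to 0 from [hi t] on; then [a_{i,t} = int f_t dG_i] tends to 0 and
   [|F_i(t) - a_{i,t}|] is at most the variation of [G_i] on [[lo t, hi t]];
   these intervals are disjoint for distinct [t].

   Conversely put [G_i = F_i o phi] minus [b_{i,t}] on each [[lo t, hi t[]. Its
   variation exceeds that of [F_i] by at most twice the sum of the [|b_{i,t}|].
   By continuity, a function on [K] is uniformly close to a combination of
   functions [w_{u,v}] increasing from 0 to 1 between [u < v]; if [phi u < phi v],
   one can take [w_{u,v} = h o phi], whose integral is [int h dF_i]; otherwise
   [int w_{u,v} dG_i = G_i(max K) - a_{i,t}] with [t = phi u].

   Measures on [K] with a given distribution function [H] are obtained as images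
   of Lebesgue measure on []0, max H]] by the quantile function
   [u |-> min {s | u <= H s}]. *)
Require Import Defs.
From HB Require Import structures.
From mathcomp Require Import all_boot all_order all_algebra.
From mathcomp Require Import all_classical all_reals all_analysis.
From mathcomp Require Import measurable_realfun lra.
Import numFieldNormedType.Exports.
Import Order.TTheory GRing.Theory Num.Theory.
Local Open Scope classical_set_scope.
Local Open Scope ring_scope.

Set Implicit Arguments.
Unset Strict Implicit.
Unset Printing Implicit Defensive.

(** * Compact lines *)

(** [K] need not be metrizable: an open set can be an uncountable union of intervals and need not be
    a countable union of closed sets. Neither the Borel measurability of the quantile function nor
    the regularity of its image measure is therefore automatic; both are reduced to countably many
    intervals by means of rational levels in []0, max H]]. [K] may also have gaps, across which a
    continuous function jumps; partitions can control it only inside their open intervals. Signed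
    measures are arbitrary differences of finite regular measures, without a minimal decomposition,
    so total masses are not controlled uniformly in [i]. They are always beaten by a small factor
    chosen afterwards, and integrals of continuous functions are compared through distribution
    functions alone. The factor 2 in the norm bound arises because subtracting [b_{i,t}] on [[lo t,
    hi t[] creates a jump at [lo t] and another at [hi t]; a nonzero value at the minimum counts as
    a jump there. *)

Section compact_line_topology.
Context {d : Order.disp_t} {K : pointedOrderTopologicalType d}.
Implicit Types (t u v x : K) (A U : set K).

Lemma nbhs_right t U : nbhs t U -> (exists u, (t < u)%O) ->
  exists u, (t < u)%O /\ forall x, (t <= x)%O -> (x < u)%O -> U x.
Proof.
rewrite itv_nbhsE => -[[a b] [/= iab tab] abU] [w tw].
move: tab; rewrite inE /= => /andP[at_ tb].
case: b iab tb abU => [bb b|[]] iab tb abU //.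
- have bbE : bb = true by move: iab; rewrite /itv_open_ends;
    case: bb {tb abU} => //; case: a {at_} => [[]|[]] ? //=; case.
  exists b; split; first by move: tb; rewrite bbE.
  move=> x tx xb; apply: abU => /=; apply/andP; split.
    exact: (le_trans at_).
  by rewrite bbE.
- exists w; split => // x tx xw; apply: abU => /=; apply/andP; split => //.
  exact: (le_trans at_).
Qed.

Lemma nbhs_left t U : nbhs t U -> (exists u, (u < t)%O) ->
  exists u, (u < t)%O /\ forall x, (u < x)%O -> (x <= t)%O -> U x.
Proof.
rewrite itv_nbhsE => -[[a b] [/= iab tab] abU] [w tw].
move: tab; rewrite inE /= => /andP[at_ tb].
case: a iab at_ abU => [ba a|[]] iab at_ abU //.
- have baE : ba = false by move: iab; rewrite /itv_open_ends;
    case: ba {at_ abU} => //; case: b {tb} => [[]|[]] ? //=; case.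
  exists a; split; first by move: at_; rewrite baE.
  move=> x ax xt; apply: abU => /=; apply/andP; split.
    by rewrite baE.
  exact: (le_trans _ tb).
- exists w; split => // x wx xt; apply: abU => /=; apply/andP; split => //.
  exact: (le_trans _ tb).
Qed.

Hypothesis cK : compact [set: K].

Lemma compact_line_sup A : A !=set0 ->
  exists x, (forall a, A a -> (a <= x)%O) /\
    (forall u, (u < x)%O -> exists a, A a /\ (u < a)%O) /\
    (closed A -> A x).
Proof.
case=> a0 Aa0.
pose F : set_system K := filter_from A (fun a => A `&` [set s | (a <= s)%O]).
have FF : ProperFilter F.
  apply: filter_from_proper; last by move=> a Aa; exists a; split => //=.
  apply: filter_from_filter; first by exists a0.
  move=> a b Aa Ab; have [ab|/ltW ba] := leP a b.
  - by exists b => // s [As /= bs]; split; split => //=; exact: le_trans bs.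
  - by exists a => // s [As /= bs]; split; split => //=; exact: le_trans bs.
have [x [_ xF]] : [set: K] `&` cluster F !=set0 by apply: cK; exact: filterT.
have FA a : A a -> F (A `&` [set s | (a <= s)%O]) by move=> Aa; exists a.
exists x; split; [|split].
- move=> a Aa; rewrite leNgt; apply/negP => xa.
  have /(xF _ _ (FA a Aa))[s [[_ /= as_]]] : nbhs x [set` `]-oo, a[%O].
    by apply: open_nbhs_nbhs; split; [exact: lray_open|rewrite /= in_itv].
  by rewrite /= in_itv /= ltNge as_.
- move=> u ux.
  have /(xF _ _ (FA _ Aa0))[s [[As _]]] : nbhs x [set` `]u, +oo[%O].
    by apply: open_nbhs_nbhs; split; [exact: rray_open|rewrite /= in_itv /= ux].
  by rewrite /= in_itv /= andbT => us; exists s.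
- move=> cA; rewrite (closure_id A).1 // => B xB.
  by have [s [[As _] Bs]] := xF _ _ (FA _ Aa0) xB; exists s.
Qed.

Lemma compact_line_inf A : A !=set0 ->
  exists x, (forall a, A a -> (x <= a)%O) /\
    (forall u, (x < u)%O -> exists a, A a /\ (a < u)%O) /\
    (closed A -> A x).
Proof.
case=> a0 Aa0.
pose F : set_system K := filter_from A (fun a => A `&` [set s | (s <= a)%O]).
have FF : ProperFilter F.
  apply: filter_from_proper; last by move=> a Aa; exists a; split => //=.
  apply: filter_from_filter; first by exists a0.
  move=> a b Aa Ab; have [ab|/ltW ba] := leP a b.
  - by exists a => // s [As /= sa]; split; split => //=; exact: le_trans ab.
  - by exists b => // s [As /= sa]; split; split => //=; exact: le_trans ba.
have [x [_ xF]] : [set: K] `&` cluster F !=set0 by apply: cK; exact: filterT.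
have FA a : A a -> F (A `&` [set s | (s <= a)%O]) by move=> Aa; exists a.
exists x; split; [|split].
- move=> a Aa; rewrite leNgt; apply/negP => xa.
  have /(xF _ _ (FA a Aa))[s [[_ /= as_]]] : nbhs x [set` `]a, +oo[%O].
    by apply: open_nbhs_nbhs; split; [exact: rray_open|rewrite /= in_itv /= xa].
  by rewrite /= in_itv /= andbT ltNge as_.
- move=> u ux.
  have /(xF _ _ (FA _ Aa0))[s [[As _]]] : nbhs x [set` `]-oo, u[%O].
    by apply: open_nbhs_nbhs; split; [exact: lray_open|rewrite /= in_itv].
  by rewrite /= in_itv /= => us; exists s.
- move=> cA; rewrite (closure_id A).1 // => B xB.
  by have [s [[As _] Bs]] := xF _ _ (FA _ Aa0) xB; exists s.
Qed.

Lemma compact_line_min : exists m : K, forall t, (m <= t)%O.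
Proof.
have [|m [mP _]] := @compact_line_inf setT; first by exists point.
by exists m => t; exact: mP.
Qed.

Lemma compact_line_max : exists m : K, forall t, (t <= m)%O.
Proof.
have [|m [mP _]] := @compact_line_sup setT; first by exists point.
by exists m => t; exact: mP.
Qed.

(* A relation that holds near each point, on the left and on the right, joins
   any two points by a finite path: the supremum of the points reachable from
   [p] is reachable, hence equal to [r]. *)
Lemma compact_line_path (r : rel K) (p q : K) : (p <= q)%O ->
  (forall t, (p < t)%O -> (t <= q)%O -> exists u0, (u0 < t)%O /\
     forall u, (p <= u)%O -> (u0 < u)%O -> (u < t)%O -> r u t) ->
  (forall t, (p <= t)%O -> (t < q)%O -> exists v, [/\ (t < v)%O, (v <= q)%O & r t v]) ->
  exists s, path r p s /\ last p s = q.
Proof.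
move=> pq left right.
pose A := [set t | [/\ (p <= t)%O, (t <= q)%O &
  exists s, path r p s /\ last p s = t]].
have Ap : A p by split => //; exists [::].
have [|x [ubx [supx _]]] := @compact_line_sup A; first by exists p.
have px : (p <= x)%O by exact: ubx.
have xq : (x <= q)%O.
  rewrite leNgt; apply/negP => /supx[a [[_ aq _]]].
  by rewrite ltNge aq.
have Ax : A x.
  move: (px); rewrite le_eqVlt => /predU1P[<-//|pltx].
  have [u0 [u0x Hu0]] := left _ pltx xq.
  have [a [[pa aq [s [ps las]]] u0a]] := supx _ u0x.
  have ax : (a <= x)%O by apply: ubx; split => //; exists s.
  split => //; move: ax; rewrite le_eqVlt => /predU1P[<-|ax]; first by exists s.
  by exists (rcons s x); rewrite rcons_path last_rcons ps las Hu0.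
move: (xq); rewrite le_eqVlt => /predU1P[<-|xltq]; first by case: Ax.
have [v [xv vq rxv]] := right _ px xltq.
suff /ubx : A v by rewrite leNgt xv.
case: Ax => _ _ [s [ps las]].
split => //; first exact: le_trans (ltW xv).
by exists (rcons s v); rewrite rcons_path last_rcons ps las rxv.
Qed.

Lemma compact_line_urysohn (R : realType) (u v : K) : (u < v)%O ->
  exists w : K -> R, [/\ continuous w, forall x, 0 <= w x <= 1,
    forall x, (x <= u)%O -> w x = 0 & forall x, (v <= x)%O -> w x = 1].
Proof.
move=> uv.
have nK : normal_space K by apply: compact_normal => //; exact: order_hausdorff.
have /(@uniform_separatorP _ R)[w [cw w01 w0 w1]] :
    uniform_separator [set` `]-oo, u]%O] [set` `[v, +oo[%O].
  apply: ((normal_separatorP (R := R)).1 nK).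
  - exact: lray_closed.
  - exact: rray_closed.
  - rewrite -subset0 => x [] /=; rewrite !in_itv /= andbT => xu vx.
    by move: uv; rewrite ltNge (le_trans vx xu).
exists w; split => //.
- by move=> x; have /= := w01 (w x) (imageT w x); rewrite in_itv.
- by move=> x xu; apply: w0; exists x => //=; rewrite in_itv.
- by move=> x vx; apply: w1; exists x => //=; rewrite in_itv /= vx.
Qed.

End compact_line_topology.

(** * Integration against a difference of two finite measures *)

Section signed_integral.
Context {R : realType} {d : Order.disp_t} {K : pointedOrderTopologicalType d}.
Implicit Types (f g : K -> R) (t : K).

(** [sintegral] applies [fine] to two integrals, so its linearity needs both to be finite. This
    class ensures it and contains the continuous functions as well as the indicators of rays. *)
Definition bounded_borel f :=
  measurable_fun [set: Borel K] (f : Borel K -> R) /\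
  exists C : R, forall x, `|f x| <= C.

Definition ray t (x : K) : R := ((x <= t)%O)%:R.

Lemma ray_le t x : (x <= t)%O -> ray t x = 1.
Proof. by rewrite /ray => ->. Qed.

Lemma ray_gt t x : (t < x)%O -> ray t x = 0.
Proof. by rewrite /ray leNgt => ->. Qed.

Lemma open_Borel (A : set K) : open A -> measurable (A : set (Borel K)).
Proof. by move=> oA; exact: sub_sigma_algebra. Qed.

Lemma closed_Borel (A : set K) : closed A -> measurable (A : set (Borel K)).
Proof.
move=> cA; rewrite -[A]setCK; apply: measurableC; apply: open_Borel.
exact: closed_openC.
Qed.

Lemma lray_Borel t : measurable ([set s : K | (s <= t)%O] : set (Borel K)).
Proof.
apply: closed_Borel; rewrite (_ : mkset _ = [set` `]-oo, t]%O]).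
  exact: lray_closed.
by apply/seteqP; split => x /=; rewrite in_itv.
Qed.

Lemma rayE t : ray t = \1_[set s : K | (s <= t)%O].
Proof.
apply/funext => x; rewrite /ray indicE; congr ((nat_of_bool _)%:R).
by apply/idP/idP; rewrite inE.
Qed.

Lemma bounded_borel_ray t : bounded_borel (ray t).
Proof.
split; first by rewrite rayE; apply: measurable_indic; exact: lray_Borel.
by exists 1 => x; rewrite /ray normr_nat lern1 leq_b1.
Qed.

Lemma bounded_borel_cst (c : R) : bounded_borel (fun=> c).
Proof. by split; [exact: measurable_cst|exists `|c|]. Qed.

Lemma bounded_borelD f g : bounded_borel f -> bounded_borel g ->
  bounded_borel (fun x => f x + g x).
Proof.
move=> [mf [C fC]] [mg [D gD]]; split; first exact: measurable_funD.
by exists (C + D) => x; rewrite (le_trans (ler_normD _ _))// lerD.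
Qed.

Lemma bounded_borelM f g : bounded_borel f -> bounded_borel g ->
  bounded_borel (fun x => f x * g x).
Proof.
move=> [mf [C fC]] [mg [D gD]]; split; first exact: measurable_funM.
by exists (C * D) => x; rewrite normrM ler_pM.
Qed.

Lemma bounded_borelZ c f : bounded_borel f -> bounded_borel (fun x => c * f x).
Proof. by apply: bounded_borelM; exact: bounded_borel_cst. Qed.

Lemma bounded_borelB f g : bounded_borel f -> bounded_borel g ->
  bounded_borel (fun x => f x - g x).
Proof.
move=> mf mg; under [X in bounded_borel X]eq_fun do rewrite -mulN1r.
by apply: bounded_borelD => //; exact: bounded_borelZ.
Qed.

Lemma continuous_bounded f : compact [set: K] -> continuous f ->
  exists C : R, forall x, `|f x| <= C.
Proof.
move=> cK cf.
have cimf : compact (range f).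
  by apply: continuous_compact => //; exact: continuous_subspaceT.
have [M [_ HM]] := compact_bounded cimf.
exists (M + 1) => x; apply: HM; first by rewrite ltrDl.
by exists x.
Qed.

Lemma bounded_borel_continuous f : compact [set: K] -> continuous f ->
  bounded_borel f.
Proof.
move=> cK cf; split; last exact: continuous_bounded.
apply: (measurability _ (RGenOpens.measurableE R)).
move=> _ [_ [a [b ->] <-]]; rewrite setTI; apply: open_Borel.
by move/continuousP : cf; apply; exact: interval_open.
Qed.

Variables mu1 mu2 : {finite_measure set (Borel K) -> \bar R}.
Notation J := (Defs.sintegral mu1 mu2).

(** The mass of [mu1 + mu2], which may exceed the total variation of [mu1 - mu2]. *)
Definition total_mass (A : set K) : R := fine (mu1 A) + fine (mu2 A).

Lemma bounded_borel_integrable (mu : {finite_measure set (Borel K) -> \bar R}) f :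
  bounded_borel f -> mu.-integrable setT (EFin \o (f : Borel K -> R)).
Proof.
move=> [mf [C fC]]; apply: measurable_bounded_integrable => //.
  by rewrite -ge0_fin_numE// fin_num_measure.
exists C; split; first exact: num_real.
by move=> M CM x _; exact: le_trans (fC x) (ltW CM).
Qed.

Lemma sintegralD f g : bounded_borel f -> bounded_borel g ->
  J (fun x => f x + g x) = J f + J g.
Proof.
move=> bf bg; rewrite /Defs.sintegral.
have := @RintegralD _ _ _ mu1 setT f g measurableT
  (bounded_borel_integrable mu1 bf) (bounded_borel_integrable mu1 bg).
have := @RintegralD _ _ _ mu2 setT f g measurableT
  (bounded_borel_integrable mu2 bf) (bounded_borel_integrable mu2 bg).
rewrite /Rintegral => -> ->; lra.
Qed.

Lemma sintegralZ c f : bounded_borel f -> J (fun x => c * f x) = c * J f.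
Proof.
move=> bf; rewrite /Defs.sintegral.
have := @RintegralZl _ _ _ mu1 setT f c measurableT
  (bounded_borel_integrable mu1 bf).
have := @RintegralZl _ _ _ mu2 setT f c measurableT
  (bounded_borel_integrable mu2 bf).
rewrite /Rintegral => -> ->; lra.
Qed.

Lemma sintegralB f g : bounded_borel f -> bounded_borel g ->
  J (fun x => f x - g x) = J f - J g.
Proof.
move=> bf bg; under [X in J X]eq_fun do rewrite -mulN1r.
by rewrite sintegralD ?sintegralZ ?mulN1r//; exact: bounded_borelZ.
Qed.

Lemma sintegral0 : J (fun=> 0) = 0.
Proof. by rewrite /Defs.sintegral !integral0 subrr. Qed.

Lemma sintegral_ray t : J (ray t) =
  fine (mu1 [set s : K | (s <= t)%O]) - fine (mu2 [set s : K | (s <= t)%O]).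
Proof.
have mt := lray_Borel t.
by rewrite /Defs.sintegral rayE !integral_indic// !setIT.
Qed.

Lemma sintegral_le f (A : set K) (c : R) : bounded_borel f ->
  measurable (A : set (Borel K)) -> 0 <= c ->
  (forall x, A x -> `|f x| <= c) -> (forall x, ~ A x -> f x = 0) ->
  `|J f| <= c * total_mass A.
Proof.
move=> bf mA c0 fc f0.
have H (mu : {finite_measure set (Borel K) -> \bar R}) :
    `|Rintegral mu setT f| <= c * fine (mu A).
  have := bounded_borel_integrable mu bf => intf.
  apply: le_trans (le_normr_Rintegral measurableT intf) _.
  have mcA : measurable_fun [set: Borel K] (fun x : Borel K => c * \1_A x).
    by apply: measurable_funM => //; exact: measurable_indic.
  have bcA : bounded_borel (fun x => c * \1_A x).
    split => //; exists c => x; rewrite indicE.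
    by case: (_ \in _); rewrite ?mulr1 ?mulr0 ?normr0// ger0_norm.
  have intA := bounded_borel_integrable mu bcA.
  apply: le_trans (_ : Rintegral mu setT (fun x : Borel K => c * \1_A x) <= _).
    apply: le_Rintegral => //.
      by exact: integrable_norm.
    move=> x _; rewrite indicE; case: (boolP (x \in A)) => [/set_mem Ax|/negP xA].
      by rewrite mulr1 fc.
    by rewrite f0 ?normr0 ?mulr0// => Ax; apply: xA; rewrite inE.
  rewrite RintegralZl//; last first.
    apply: bounded_borel_integrable; split; first exact: measurable_indic.
    by exists 1 => x; rewrite indicE normr_nat lern1 leq_b1.
  by rewrite /Rintegral integral_indic// setIT.
rewrite /Defs.sintegral -/(Rintegral mu1 setT f) -/(Rintegral mu2 setT f).
rewrite /total_mass mulrDr.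
by rewrite (le_trans (ler_normB _ _))// lerD.
Qed.

Lemma total_mass_ge0 (A : set K) : 0 <= total_mass A.
Proof. by rewrite /total_mass addr_ge0 ?fine_ge0. Qed.

Lemma sintegral_dist f g (c : R) : bounded_borel f -> bounded_borel g ->
  (forall x, `|f x - g x| <= c) -> `|J f - J g| <= c * total_mass setT.
Proof.
move=> bf bg fg; rewrite -sintegralB//.
apply: sintegral_le => //; first exact: bounded_borelB.
  exact: le_trans (normr_ge0 _) (fg point).
by move=> x /(_ I).
Qed.

End signed_integral.

(** * Riemann-Stieltjes sums *)

Section riemann_stieltjes.
Context {R : realType} {d : Order.disp_t} {K : pointedOrderTopologicalType d}.
Hypothesis cK : compact [set: K].
Implicit Types (f G : K -> R) (t u v x : K) (s : seq K).

Lemma varsum_cons2 f x y s :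
  varsum f (x :: y :: s) = `|f y - f x| + varsum f (y :: s).
Proof. by rewrite /varsum /= big_cons. Qed.

Lemma varsum1 f x : varsum f [:: x] = 0.
Proof. by rewrite /varsum /= big_nil. Qed.

(** The value on []u, y]] is that of [f] at the right end. As []u, y]] has measure [G y - G u], the
    integral is exactly [rs_sum]. *)
Fixpoint step_fun f u s : K -> R :=
  if s is y :: s' then
    fun x => f y * (ray y x - ray u x) + step_fun f y s' x
  else fun=> 0.

Fixpoint rs_sum f G u s : R :=
  if s is y :: s' then f y * (G y - G u) + rs_sum f G y s' else 0.

(** Interior points are compared with both ends, but [f u] is never compared with [f v]: across a
    gap a continuous function may jump, and no finite path could make that difference small. *)
Definition slow f (e : R) : rel K := fun u v =>
  (u < v)%O && `[< forall x, (u < x)%O -> (x < v)%O ->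
                   `|f x - f u| <= e /\ `|f x - f v| <= e >].

Lemma path_slow_lt f e u s : path (slow f e) u s -> path <%O u s.
Proof. by apply: sub_path => x y /andP[]. Qed.

Lemma path_lt_last u s x : path <%O u s -> (x <= u)%O -> (x <= last u s)%O.
Proof.
elim: s u => //= y s IH u /andP[uy ys] xu; apply: IH => //.
exact: le_trans (ltW uy).
Qed.

Lemma slow_path f (e : R) (p q : K) : continuous f -> 0 < e -> (p <= q)%O ->
  exists s, path (slow f e) p s /\ last p s = q.
Proof.
move=> cf e0 pq.
have nb t : nbhs t [set x | `|f x - f t| < e / 2].
  have /cf : nbhs (f t) [set y | `|y - f t| < e / 2].
    apply/nbhs_ballP; exists (e / 2) => /=; first by rewrite divr_gt0.
    by move=> y /=; rewrite /ball /= distrC.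
  exact.
apply: compact_line_path => // t.
- move=> pt tq.
  have [|u0 [u0t Hu0]] := nbhs_left (nb t); first by exists p.
  exists u0; split => // u pu u0u ut; apply/andP; split => //.
  apply/asboolP => x ux xt.
  have xf := Hu0 x (lt_trans u0u ux) (ltW xt).
  have uf := Hu0 u u0u (ltW ut).
  move: xf uf => /= xf uf; split; last by apply: le_trans (ltW xf) _; lra.
  rewrite (_ : f x - f u = (f x - f t) - (f u - f t)); last by lra.
  by rewrite (le_trans (ler_normB _ _))//; lra.
- move=> pt tq.
  have [|v [tv Hv]] := nbhs_right (nb t); first by exists q.
  have Hf x : (t <= x)%O -> (x < v)%O -> `|f x - f t| < e / 2 by exact: Hv.
  (* If no point of []t, v[] is at most [q], then []t, v[] is a gap and [slow f e t v] holds
     vacuously. *)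
  have [[w [tw wv wq]]|nw] := pselect (exists w, [/\ (t < w)%O, (w < v)%O & (w <= q)%O]).
    exists w; split => //; apply/andP; split => //.
    apply/asboolP => x tx xw.
    have xf := Hf x (ltW tx) (lt_trans xw wv).
    have wf := Hf w (ltW tw) wv.
    split; first by apply: le_trans (ltW xf) _; lra.
    rewrite (_ : f x - f w = (f x - f t) - (f w - f t)); last by lra.
    by rewrite (le_trans (ler_normB _ _))//; lra.
  have vq : (v <= q)%O.
    rewrite leNgt; apply/negP => qv; apply: nw; exists q; split => //.
  exists v; split => //; apply/andP; split => //.
  apply/asboolP => x tx xv; case: nw; exists x; split => //.
  exact: le_trans (ltW xv) vq.
Qed.

Lemma step_fun_le f u s x : path <%O u s -> (x <= u)%O -> step_fun f u s x = 0.
Proof.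
elim: s u => //= y s IH u /andP[uy ys] xu.
rewrite IH//; last exact: le_trans (ltW uy).
by rewrite !ray_le ?subrr ?mulr0 ?addr0// (le_trans xu (ltW uy)).
Qed.

Lemma step_fun_gt f u s x : path <%O u s -> (last u s < x)%O ->
  step_fun f u s x = 0.
Proof.
elim: s u => //= y s IH u /andP[uy ys] lx.
have yx : (y < x)%O by exact: le_lt_trans (path_lt_last ys (lexx y)) lx.
by rewrite IH// !ray_gt ?subrr ?mulr0 ?addr0// (lt_trans uy).
Qed.

Lemma step_fun_approx f (e : R) u s x : 0 <= e -> path (slow f e) u s ->
  (u < x)%O -> (x <= last u s)%O -> `|f x - step_fun f u s x| <= e.
Proof.
move=> e0; elim: s u => [|y s IH] u /=.
  by move=> _ ux; rewrite leNgt ux.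
move=> /andP[/andP[uy /asboolP fuy] ys] ux xl.
have ysl := path_slow_lt ys.
have [yx|xy] := ltP y x.
  by rewrite !ray_gt// subrr mulr0 add0r IH.
rewrite ray_le// ray_gt// (step_fun_le _ ysl xy) addr0 subr0 mulr1.
move: xy; rewrite le_eqVlt => /predU1P[->|xy]; first by rewrite subrr normr0.
by have [] := fuy x ux xy.
Qed.

Lemma bounded_borel_step f u s : bounded_borel (step_fun f u s).
Proof.
elim: s u => /= [|y s IH] u; first exact: bounded_borel_cst.
apply: bounded_borelD => //; apply: bounded_borelZ.
by apply: bounded_borelB; exact: bounded_borel_ray.
Qed.

Lemma rs_sum_le f G (C : R) u s : (forall x, `|f x| <= C) ->
  `|rs_sum f G u s| <= C * varsum G (u :: s).
Proof.
move=> fC; elim: s u => [|y s IH] u /=; first by rewrite normr0 varsum1 mulr0.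
rewrite varsum_cons2 (mulrDr C) (le_trans (ler_normD _ _))// lerD//.
by rewrite normrM ler_wpM2r.
Qed.

Variables mu1 mu2 : {finite_measure set (Borel K) -> \bar R}.
Notation J := (Defs.sintegral mu1 mu2).
Notation mass := (total_mass mu1 mu2).
Variable G : K -> R.
Hypothesis aG : associated G mu1 mu2.

Lemma sintegral_ray_assoc t : J (ray t) = G t.
Proof. by rewrite sintegral_ray aG. Qed.

Lemma sintegral_step f u s : J (step_fun f u s) = rs_sum f G u s.
Proof.
elim: s u => /= [|y s IH] u; first by rewrite sintegral0.
have br := bounded_borelB (@bounded_borel_ray R _ K y) (bounded_borel_ray u).
rewrite sintegralD; [|exact: bounded_borelZ|exact: bounded_borel_step].
rewrite sintegralZ// sintegralB; [|exact: bounded_borel_ray..].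
by rewrite !sintegral_ray_assoc IH.
Qed.

(** The factor [ray q - ray p] restricts to []p, q]], where a slow path makes [step_fun] uniformly
    [e]-close to [f]. *)
Lemma sintegral_rs f (p q : K) (e : R) : continuous f -> 0 < e -> (p <= q)%O ->
  exists s, [/\ path <%O p s, last p s = q &
    `|J (fun x => f x * (ray q x - ray p x)) - rs_sum f G p s| <= e * mass setT].
Proof.
move=> cf e0 pq; have [s [ps lq]] := slow_path cf e0 pq.
have psl := path_slow_lt ps.
exists s; split => //; rewrite -sintegral_step.
apply: sintegral_dist.
- apply: bounded_borelM; first exact: bounded_borel_continuous.
  by apply: bounded_borelB; exact: bounded_borel_ray.
- exact: bounded_borel_step.
move=> x; have [xp|px] := leP x p.
  rewrite step_fun_le// !ray_le ?(le_trans xp)//.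
  by rewrite subrr mulr0 subrr normr0 ltW.
have [xq|qx] := leP x q.
  rewrite ray_le// ray_gt// subr0 mulr1 step_fun_approx ?lq//; exact: ltW.
by rewrite step_fun_gt ?lq// !ray_gt// subrr mulr0 subrr normr0 ltW.
Qed.

Lemma ler_addgt0M (a b B : R) : 0 <= B ->
  (forall e, 0 < e -> a <= b + e * B) -> a <= b.
Proof.
move=> B0 H; apply/ler_addgt0Pr => e e0.
have B1 : 0 < B + 1 by lra.
apply: le_trans (H (e / (B + 1)) _) _; first by rewrite divr_gt0.
rewrite lerD2l mulrAC ler_pdivrMr// ler_wpM2l; lra.
Qed.

Lemma sintegral_le_bv f (C V : R) (m : K) : continuous f ->
  (forall x, `|f x| <= C) -> (forall t, (m <= t)%O) ->
  (forall s, sorted <%O s -> varsum G s <= V) ->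
  `|J f| <= C * (`|G m| + V).
Proof.
move=> cf fC mP GV.
have C0 : 0 <= C by exact: le_trans (normr_ge0 _) (fC point).
have [M MP] := compact_line_max cK.
apply: (@ler_addgt0M _ _ (mass setT)); first exact: total_mass_ge0.
move=> e e0; have [s [ps _ Hs]] := sintegral_rs cf e0 (mP M).
(* The half-open intervals of the path miss the minimum [m], whose measure is [G m]; this gives the
   term [|G m|] of the BV norm. *)
have fE : f = (fun x => f m * ray m x + f x * (ray M x - ray m x)).
  apply/funext => x; rewrite (ray_le (MP x)).
  have [xm|mx] := leP x m; last by rewrite ray_gt//; lra.
  have -> : x = m by apply/eqP; rewrite eq_le xm mP.
  by rewrite ray_le//; lra.
rewrite {1}fE sintegralD; first last.
- apply: bounded_borelM; first exact: bounded_borel_continuous.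
  by apply: bounded_borelB; exact: bounded_borel_ray.
- by apply: bounded_borelZ; exact: bounded_borel_ray.
rewrite sintegralZ ?sintegral_ray_assoc; last exact: bounded_borel_ray.
set X := J _ in Hs *.
rewrite (mulrDr C) -addrA (le_trans (ler_normD _ _))// lerD//.
  by rewrite normrM ler_wpM2r.
have -> : X = rs_sum f G m s + (X - rs_sum f G m s) by lra.
rewrite (le_trans (ler_normD _ _))// lerD//.
apply: le_trans (rs_sum_le _ _ _ fC) _.
by rewrite ler_wpM2l// GV.
Qed.

(** Outer regularity: an open set that contains the ray and has nearly the same measure contains
    some []-oo, u[] with [t < u]. *)
Lemma regular_lray_rc (mu : {finite_measure set (Borel K) -> \bar R}) t v (e : R) :
  regular_measure mu -> (t < v)%O -> 0 < e ->
  exists u, [/\ (t < u)%O, (u <= v)%O &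
    fine (mu [set x : K | (x < u)%O]) <= fine (mu [set x : K | (x <= t)%O]) + e].
Proof.
move=> rmu tv e0.
have mt := lray_Borel t.
have [_ Einf] := rmu _ mt.
have fint : mu [set s : K | (s <= t)%O] \is a fin_num by exact: fin_num_measure.
have : (mu [set s : K | (s <= t)%O] < mu [set s : K | (s <= t)%O] + e%:E)%E.
  by rewrite lteDl// lte_fin.
rewrite {1}Einf => /ereal_inf_lt[_ [U [oU tU] <-] ltU].
have [||u0 [tu0 Hu0]] := @nbhs_right _ _ t U; [|by exists v|].
  by apply: open_nbhs_nbhs; split => //; apply: tU => /=.
exists (Order.min u0 v); split.
- by rewrite lt_min tu0.
- by rewrite ge_min lexx orbT.
have sub : [set x : K | (x < Order.min u0 v)%O] `<=` U.
  move=> x /=; rewrite lt_min => /andP[xu0 _].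
  by have [xt|/ltW tx] := leP x t; [exact: tU|exact: Hu0].
have mU := open_Borel oU.
have mx : measurable ([set x : K | (x < Order.min u0 v)%O] : set (Borel K)).
  apply: open_Borel; rewrite (_ : mkset _ = [set` `]-oo, (Order.min u0 v)[%O]).
    exact: lray_open.
  by apply/seteqP; split => x /=; rewrite in_itv.
rewrite -lee_fin EFinD !fineK ?fin_num_measure//.
apply: le_trans (ltW ltU).
by apply: le_measure => //; rewrite inE.
Qed.

Hypotheses (rmu1 : regular_measure mu1) (rmu2 : regular_measure mu2).

(** A Urysohn function falling from 1 to 0 between [t] and [u] differs from [ray t] only on []t,
    u[], and [u] is chosen so that this interval has mass at most [e / 2] for each measure. The
    point [v] is prescribed so that such functions can be glued in [varsum_le_sintegral]. *)
Lemma regular_ray_approx t v (e : R) : (t < v)%O -> 0 < e ->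
  exists h : K -> R, [/\ continuous h, forall x, 0 <= h x <= 1,
    forall x, (x <= t)%O -> h x = 1, forall x, (v <= x)%O -> h x = 0 &
    `|J h - G t| <= e].
Proof.
move=> tv e0.
have e2 : 0 < e / 2 by rewrite divr_gt0.
have [u1 [tu1 u1v Hu1]] := regular_lray_rc rmu1 tv e2.
have [u2 [tu2 u2v Hu2]] := regular_lray_rc rmu2 tv e2.
pose u := Order.min u1 u2.
have tu : (t < u)%O by rewrite lt_min tu1.
have uv : (u <= v)%O by rewrite ge_min u1v.
have [w [cw w01 w0 w1]] := compact_line_urysohn cK R tu.
have ch : continuous (fun x => 1 - w x).
  by move=> x; apply: cvgB; [exact: cvg_cst|exact: cw].
exists (fun x => 1 - w x); split => //.
- by move=> x; have := w01 x; lra.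
- by move=> x /w0 ->; rewrite subr0.
- by move=> x vx; rewrite w1 ?subrr// (le_trans uv).
pose A := [set x : K | (t < x)%O /\ (x < u)%O].
have mlt (z : K) : measurable ([set x : K | (x < z)%O] : set (Borel K)).
  apply: open_Borel; rewrite (_ : mkset _ = [set` `]-oo, z[%O]).
    exact: lray_open.
  by apply/seteqP; split => x /=; rewrite in_itv.
have mt := lray_Borel t.
have AE : A = [set x : K | (x < u)%O] `\` [set x : K | (x <= t)%O].
  apply/seteqP; split => x /=.
    by move=> [tx xu]; split => //; apply/negP; rewrite -ltNge.
  by move=> [xu /negP]; rewrite -ltNge.
have mA : measurable (A : set (Borel K)) by rewrite AE; exact: measurableD.
have HA (mu : {finite_measure set (Borel K) -> \bar R}) u' : (u <= u')%O ->
    fine (mu [set x : K | (x < u')%O]) <= fine (mu [set x : K | (x <= t)%O]) + e / 2 ->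
    fine (mu A) <= e / 2.
  move=> uu' H.
  suff : fine (mu A) + fine (mu [set x : K | (x <= t)%O]) <=
    fine (mu [set x : K | (x < u')%O]) by lra.
  rewrite -fineD ?fin_num_measure// -measureU//; last first.
    rewrite -subset0 => x [[tx _] /=]; rewrite leNgt tx //.
  apply: fine_le; rewrite ?fin_num_measure//; first exact: measurableU.
  apply: le_measure; rewrite ?inE//; first exact: measurableU.
  move=> x [[_ xu]|xt] /=; first exact: lt_le_trans xu uu'.
  exact: le_lt_trans xt (lt_le_trans tu uu').
have bh := bounded_borel_continuous cK ch.
rewrite -sintegral_ray_assoc -sintegralB//; last exact: bounded_borel_ray.
apply: le_trans (_ : 1 * mass A <= _).
  apply: sintegral_le => //.
  - by apply: bounded_borelB => //; exact: bounded_borel_ray.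
  - move=> x [tx _]; rewrite ray_gt// subr0.
    by have := w01 x; rewrite ler_norml; lra.
  - move=> x nA; have [xt|tx] := leP x t.
      by rewrite ray_le// w0//; lra.
    rewrite ray_gt// w1; first by lra.
    by rewrite leNgt; apply/negP => xu; exact: nA.
rewrite mul1r /total_mass.
have := HA mu1 u1 _ Hu1; rewrite ge_min lexx => /(_ isT).
have := HA mu2 u2 _ Hu2; rewrite ge_min lexx orbT => /(_ isT).
lra.
Qed.

End riemann_stieltjes.

(** * Uniform boundedness *)

Section uniform_boundedness.
Context {R : realType}.

Lemma continuousZr (T : topologicalType) (c : R) (f : T -> R) :
  continuous f -> continuous (fun x => c * f x).
Proof. by move=> cf x; apply: cvgM; [exact: cvg_cst|exact: cf]. Qed.

Lemma continuousDr (T : topologicalType) (f g : T -> R) :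
  continuous f -> continuous g -> continuous (fun x => f x + g x).
Proof. by move=> cf cg x; apply: cvgD; [exact: cf|exact: cg]. Qed.

Lemma unif_limit_continuous (T : topologicalType) (g : nat -> T -> R) (h : T -> R) :
  (forall n, continuous (g n)) ->
  (forall e, 0 < e -> exists n, forall x, `|h x - g n x| <= e) ->
  continuous h.
Proof.
move=> cg gh x; apply/cvgrPdist_lt => e e0.
have e3 : 0 < e / 3 by rewrite divr_gt0.
have [n Hn] := gh _ e3.
have := cg n x => /cvgrPdist_lt/(_ _ e3); apply: filterS => y.
have := Hn x; have := Hn y; rewrite !ler_norml !ltr_norml; lra.
Qed.

(* Gliding hump: if the bound failed, one could build a uniformly convergent
   series of small continuous functions on which the functionals are unbounded. *)
Lemma uniform_boundedness (T : topologicalType) (I : Type)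
  (J : I -> (T -> R) -> R) (B : I -> R) :
  (forall i (f g : T -> R), continuous f -> continuous g ->
    J i (fun x => f x + g x) = J i f + J i g) ->
  (forall i (c : R) (f : T -> R), continuous f -> J i (fun x => c * f x) = c * J i f) ->
  (forall i (c : R) (f : T -> R), continuous f -> 0 <= c -> (forall x, `|f x| <= c) ->
    `|J i f| <= c * B i) ->
  (forall f : T -> R, continuous f -> exists C, forall i, `|J i f| <= C) ->
  exists N, forall i (f : T -> R), continuous f -> (forall x, `|f x| <= 1) -> `|J i f| <= N.
Proof.
move=> JD JZ JB Jpt; apply: contrapT => /forallNP nN.
have {}nN N : exists i (f : T -> R), [/\ continuous f, forall x, `|f x| <= 1 & N < `|J i f|].
  apply: contrapT => H; apply: (nN N) => i f cf f1.
  rewrite leNgt; apply/negP => ?; apply: H; by exists i, f.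
(* A state is a function with the radius within which the next function must stay. *)
pose St := {p : (T -> R) * R | continuous p.1 /\ 0 < p.2}.
have step (ns : nat * St) : exists s' : St, 
    [/\ forall x, `|(sval s').1 x - (sval ns.2).1 x| <= (sval ns.2).2,
        2 * (sval s').2 <= (sval ns.2).2 &
        exists i, 2 * (sval s').2 * B i <= 1 /\ ns.1%:R <= `|J i (sval s').1|].
  case: ns => n [[g r] /= [cg r0]].
  have [i [f [cf f1 fN]]] := nN (n%:R / r).
  have {}fN : n%:R < r * `|J i f| by rewrite mulrC -ltr_pdivrMr.
  (* The first bound makes the series converge with tail at most [2 * r']; the second makes that
     tail change [J i] by at most 1. *)
  pose r' := Num.min (r / 2) (2 * (`|B i| + 1))^-1.
  have B0 : 0 < 2 * (`|B i| + 1) by have := normr_ge0 (B i); lra.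
  have r'0 : 0 < r' by rewrite lt_min divr_gt0//= invr_gt0.
  have r'r : 2 * r' <= r.
    have : r' <= r / 2 by rewrite ge_min lexx.
    by lra.
  have r'B : 2 * r' * B i <= 1.
    have H : r' <= (2 * (`|B i| + 1))^-1 by rewrite ge_min lexx orbT.
    move: H; rewrite -[_^-1]mul1r ler_pdivlMr// => H; apply: le_trans H.
    by rewrite -mulrA mulrCA ler_wpM2l ?(ltW r'0)// ler_wpM2l//; have := ler_norm (B i); lra.
  (* The values of [J i] at [g + r f] and [g - r f] differ by [2 r J i f], of modulus above [2 n],
     so one of them has modulus at least [n]. *)
  have [s [s1 Hs]] : exists s : R, `|s| <= 1 /\ n%:R <= `|J i (fun x => g x + s * r * f x)|.
    have [H|H] := leP n%:R `|J i (fun x => g x + 1 * r * f x)|.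
      by exists 1; rewrite normr1.
    exists (-1); rewrite normrN1; split => //.
    have cZ s : continuous (fun x => s * r * f x) by exact: continuousZr.
    move: H; rewrite !JD ?JZ// => H.
    have E : J i g + 1 * r * J i f - (J i g + -1 * r * J i f) = 2 * (r * J i f) by lra.
    have : `|2 * (r * J i f)| <= `|J i g + 1 * r * J i f| + `|J i g + -1 * r * J i f|.
      by rewrite -E ler_normB.
    rewrite !normrM normr_nat (gtr0_norm r0); lra.
  have cg' : continuous (fun x => g x + s * r * f x).
    by apply: continuousDr => //; exact: continuousZr.
  exists (exist (fun p : (T -> R) * R => continuous p.1 /\ 0 < p.2)
    ((fun x => g x + s * r * f x), r') (conj cg' r'0)) => /=.
  split => //; last by exists i.
  move=> x; rewrite addrC addKr !normrM (gtr0_norm r0).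
  by rewrite mulrAC -[leRHS]mul1r ler_wpM2r ?(ltW r0)// mulr_ile1.
have [Fs HF] := choice step.
have s0P : continuous ((fun=> 0 : R) : T -> R) /\ (0 : R) < 1.
  by split => //; exact: cst_continuous.
pose s0 : St := exist _ ((fun=> 0), 1) s0P.
pose u : nat -> St := nat_rect (fun=> St) s0 (fun n s => Fs (n, s)).
pose g n := (sval (u n)).1; pose r n := (sval (u n)).2.
have cg n : continuous (g n) by rewrite /g; case: (u n) => p [].
have r0 n : 0 < r n by rewrite /r; case: (u n) => p [].
have gS n x : `|g n.+1 x - g n x| <= r n by have [H _ _] := HF (n, u n); exact: H.
have rS n : 2 * r n.+1 <= r n by have [_ H _] := HF (n, u n); exact: H.
have iS n : exists i, 2 * r n.+1 * B i <= 1 /\ n%:R <= `|J i (g n.+1)|.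
  by have [_ _ H] := HF (n, u n); exact: H.
have gk n k x : `|g (n + k)%N x - g n x| <= 2 * r n - 2 * r (n + k)%N.
  elim: k => [|k IH]; first by rewrite addn0 !subrr normr0.
  rewrite addnS -(subrKA (g (n + k)%N x)) (le_trans (ler_normD _ _))//.
  have := gS (n + k)%N x; have := rS (n + k)%N; lra.
have gmn n m x : g n x - 2 * r n <= g m x + 2 * r m.
  have := r0 n; have := r0 m.
  case: (leqP n m) => [nm|/ltnW mn].
    by have := gk n (m - n)%N x; rewrite subnKC// ler_norml; lra.
  by have := gk m (n - m)%N x; rewrite subnKC// ler_norml; lra.
(* Any two of the intervals of radius [2 * r n] about [g n x] meet, so the supremum of their lower
   ends lies in all of them. *)
pose A x := [set g n x - 2 * r n | n in [set: nat]].
pose h x := sup (A x).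
have A0 x : A x !=set0 by exists (g 0%N x - 2 * r 0%N); exists 0%N.
have hg n x : `|h x - g n x| <= 2 * r n.
  have supA : has_sup (A x).
    by split => //; exists (g n x + 2 * r n) => _ [m _ <-]; exact: gmn.
  have h1 : g n x - 2 * r n <= h x by apply: sup_upper_bound => //; exists n.
  have h2 : h x <= g n x + 2 * r n.
    by apply: ge_sup => // _ [m _ <-]; exact: gmn.
  by rewrite ler_norml; lra.
(* The radii at least halve and [n + 2 <= 2 (n + 1)]. *)
have rn n : r n * n.+1%:R <= 1.
  elim: n => [|n IH]; first by rewrite mulr1 /r /=.
  have := rS n; have := r0 n.+1; move: IH; rewrite -!natr1 => IH r00 rr.
  have := ler0n R n; nra.
have ch : continuous h.
  apply: (unif_limit_continuous cg) => e e0.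
  have [n Hn] : exists n : nat, 2 * r n <= e.
    have := archi_boundP (ltW (divr_gt0 (ltr0n R 2) e0)).
    set n := Num.bound _ => Hn; exists n.
    have := rn n; rewrite ltr_pdivrMr// in Hn; rewrite -natr1 => rr.
    have := r0 n => r0n.
    have n0 : 0 < n%:R :> R.
      move: Hn; have := ler0n R n.
      by rewrite le_eqVlt => /predU1P[<-|//]; rewrite mul0r; lra.
    have : 2 * r n <= n%:R * r n * e by rewrite mulrAC ler_pM2r// ltW.
    move=> /le_trans; apply; rewrite -[leRHS]mul1r ler_wpM2r ?ltW//; nra.
  by exists n => x; exact: le_trans (hg n x) Hn.
have [C HC] := Jpt h ch.
have C0 : 0 <= C by have [i _] := iS 0%N; exact: le_trans (normr_ge0 _) (HC i).
(* With [n > C + 1], the value [J i (g n.+1)] has modulus at least [n] and differs from [J i h] by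
   at most 1. *)
have := archi_boundP (ler_wpDr ler01 C0); set n := Num.bound _ => Cn.
have [i [Bi Ji]] := iS n.
have := HC i; apply/negP; rewrite -ltNge.
have : `|J i (fun x => h x + -1 * g n.+1 x)| <= 2 * r n.+1 * B i.
  apply: JB.
  - by apply: continuousDr => //; exact: continuousZr.
  - by have := r0 n.+1; lra.
  - by move=> x; rewrite mulN1r.
rewrite JD ?JZ//; last exact: continuousZr.
rewrite mulN1r => H.
have := ler_normB (J i h) (J i h - J i (g n.+1)).
rewrite opprB addrC subrK => H2.
lra.
Qed.

Lemma c0lim_bounded (I : Type) (a : I -> R) : c0lim a ->
  exists C, forall i, `|a i| <= C.
Proof.
move=> /(_ 1 ltr01) fA.
(* [I] is a bare type, so the finitely many large values are listed instead of their indices. *)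
have := finite_image (fun i => `|a i|) fA => /finite_seqP[s Hs].
exists (1 + \sum_(y <- s) `|y|) => i.
have S0 : 0 <= \sum_(y <- s) `|y| by rewrite sumr_ge0.
have [ai|/ltW ai] := leP 1 `|a i|; last by lra.
have : `|a i| \in s.
  have : [set` s] `|a i| by rewrite -Hs; exists i.
  by [].
move=> ais; rewrite (big_rem _ ais)/= normr_id.
have : 0 <= \sum_(y <- rem `|a i| s) `|y| by rewrite sumr_ge0.
lra.
Qed.

Context {d : Order.disp_t} {K : pointedOrderTopologicalType d}.
Hypothesis cK : compact [set: K].

Section one_measure.
Variables mu1 mu2 : {finite_measure set (Borel K) -> \bar R}.
Notation J := (Defs.sintegral mu1 mu2).
Variable G : K -> R.
Hypotheses (aG : associated G mu1 mu2)
  (rmu1 : regular_measure mu1) (rmu2 : regular_measure mu2).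

Lemma ray_approx t (e : R) : 0 < e ->
  exists h : K -> R, [/\ continuous h, forall x, 0 <= h x <= 1,
    forall x, (x <= t)%O -> h x = 1 & `|J h - G t| <= e].
Proof.
move=> e0; have [[v tv]|nv] := pselect (exists v, (t < v)%O).
  have [h [ch h01 h1 _ Jh]] := regular_ray_approx cK aG rmu1 rmu2 tv e0.
  by exists h.
exists (fun=> 1); split => //.
- exact: cst_continuous.
- by move=> x; rewrite ler01 lexx.
rewrite (_ : (fun=> 1) = ray t); last first.
  apply/funext => x; rewrite ray_le// leNgt; apply/negP => tx; apply: nv.
  by exists x.
by rewrite (sintegral_ray_assoc aG) subrr normr0 ltW.
Qed.

(** The test function follows the signs of the increments of [G]. The induction starts from the
    right: adding [(sg - sg') * h], with [h] close to [ray x] and zero from [y] on, resets the value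
    up to [x] to [sg]. This adds nearly [(sg - sg') * G x] to the integral, and [sg' * (G y - G x)]
    is the modulus of the new increment. *)
Lemma varsum_le_sintegral (sg e : R) (x : K) (s : seq K) : `|sg| <= 1 -> 0 < e ->
  path <%O x s ->
  exists g : K -> R, [/\ continuous g, forall y, `|g y| <= 1,
    forall y, (y <= x)%O -> g y = sg &
    sg * G x + varsum G (x :: s) <= J g + e].
Proof.
elim: s x sg e => [|y s IH] x sg e sg1 e0.
  move=> _; have [h [ch h01 h1 Jh]] := ray_approx x e0.
  exists (fun x => sg * h x); split.
  - exact: continuousZr.
  - move=> y; have := h01 y => /andP[h0 hle].
    by rewrite normrM (ger0_norm h0) mulr_ile1.
  - by move=> y /h1 ->; rewrite mulr1.
  rewrite varsum1 addr0 sintegralZ; last exact: bounded_borel_continuous.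
  have : `|sg * (J h - G x)| <= e.
    by rewrite normrM -[leRHS]mul1r ler_pM.
  by rewrite ler_norml; lra.
move=> /= /andP[xy ys].
have e3 : 0 < e / 3 by rewrite divr_gt0.
pose sg' := Num.sg (G y - G x).
have sg'1 : `|sg'| <= 1 by rewrite normr_sg lern1 leq_b1.
have [g [cg g1 gy Jg]] := IH y sg' (e / 3) sg'1 e3 ys.
have [h [ch h01 h1 h0 Jh]] := regular_ray_approx cK aG rmu1 rmu2 xy e3.
exists (fun z => g z + (sg - sg') * h z); split.
- by apply: continuousDr => //; exact: continuousZr.
- move=> z; have [zy|/ltW yz] := leP z y; last by rewrite h0// mulr0 addr0.
  rewrite gy//; have := h01 z; move: sg1 sg'1; rewrite !ler_norml.
  by move=> /andP[? ?] /andP[? ?] /andP[? ?]; apply/andP; split; nra.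
- by move=> z zx; rewrite h1// gy; [lra|exact: le_trans zx (ltW xy)].
rewrite varsum_cons2.
rewrite sintegralD; [|exact: bounded_borel_continuous|]; last first.
  by apply: bounded_borel_continuous => //; exact: continuousZr.
rewrite sintegralZ; last exact: bounded_borel_continuous.
have : `|G y - G x| = sg' * (G y - G x) by rewrite /sg' -normrEsg.
move=> ->.
have : `|(sg - sg') * (J h - G x)| <= 2 * (e / 3).
  rewrite normrM ler_pM//.
  by apply: le_trans (ler_normB _ _) _; lra.
by rewrite ler_norml; lra.
Qed.

End one_measure.

(** Total masses bound each functional and nullity bounds the family at each [f], so some [N] bounds
    all of them on the unit ball. The test functions of [ray_approx], and those of
    [varsum_le_sintegral] with initial value 0, transfer this to values and variation sums. *)
Lemma wstar_null_bounded (I : Type) (F : I -> K -> R) : wstar_null F ->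
  exists B, forall i, (forall t, `|F i t| <= B) /\
    (forall s, sorted <%O s -> varsum (F i) s <= B).
Proof.
move=> [_ [mu1 [mu2 [H null]]]].
have [||||N HN] := @uniform_boundedness K I (fun i => Defs.sintegral (mu1 i) (mu2 i))
    (fun i => total_mass (mu1 i) (mu2 i) setT).
- by move=> i f g cf cg; apply: sintegralD; exact: bounded_borel_continuous.
- by move=> i c f cf; apply: sintegralZ; exact: bounded_borel_continuous.
- move=> i c f cf c0 fc; apply: sintegral_le => //.
    exact: bounded_borel_continuous.
  by move=> x []; exact.
- by move=> f cf; apply: c0lim_bounded; exact: null.
exists (N + 1 + N + 1) => i; have [r1 [r2 aF]] := H i.
have Ft t : `|F i t| <= N + 1.
  have [h [ch h01 h1 Jh]] := ray_approx aF r1 r2 t ltr01.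
  have Nh : `|Defs.sintegral (mu1 i) (mu2 i) h| <= N.
    by apply: HN => // x; have := h01 x; rewrite ler_norml; lra.
  by move: Nh; move: Jh; rewrite !ler_norml; lra.
have N0 : 0 <= N.
  apply: le_trans (normr_ge0 _) (HN i (fun=> 0) _ _) => //.
    exact: cst_continuous.
  by move=> x; rewrite normr0.
split; first by move=> t; have := Ft t; lra.
case=> [|x s]; first by rewrite /varsum big_nil; lra.
move=> /= xs.
have [|g [cg g1 _ Jg]] := varsum_le_sintegral aF r1 r2 (sg := 0) _ ltr01 xs.
  by rewrite normr0.
have := HN i g cg g1; have := ler_norm (Defs.sintegral (mu1 i) (mu2 i) g).
by move: Jg; rewrite mul0r add0r; lra.
Qed.

End uniform_boundedness.

(** * Regular measures with a given distribution function *)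

Section image_measure_on.
Context d d' (T1 : measurableType d) (T2 : measurableType d') (R : realType).
Variables (m : {measure set T1 -> \bar R}) (D : set T1) (q : T1 -> T2).
Hypotheses (mD : measurable D) (finD : m D \is a fin_num)
  (mq : measurable_fun D q).

(* The hypotheses are arguments so that the measure structure can be inferred
   from the term. *)
Definition image_measure_on of measurable D & m D \is a fin_num &
  measurable_fun D q := fun A => m (D `&` q @^-1` A).

Local Notation im := (image_measure_on mD finD mq).

Let im0 : im set0 = 0%E.
Proof. by rewrite /image_measure_on preimage_set0 setI0 measure0. Qed.

Let im_ge0 A : (0 <= im A)%E.
Proof. exact: measure_ge0. Qed.

Let im_sigma_additive : semi_sigma_additive im.
Proof.
move=> F mF tF mUF; rewrite /image_measure_on preimage_bigcup setI_bigcupr.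
apply: measure_semi_sigma_additive.
- by move=> n; exact: mq.
- apply/trivIsetP => /= i j _ _ ij; rewrite setIACA -preimage_setI.
  by move/trivIsetP : tF => /(_ _ _ _ _ ij) ->//; rewrite preimage_set0 setI0.
- by rewrite -setI_bigcupr -preimage_bigcup; exact: mq.
Qed.

HB.instance Definition _ := isMeasure.Build _ _ _ im
  im0 im_ge0 im_sigma_additive.

Let im_fin : fin_num_fun im.
Proof.
move=> A mA; rewrite ge0_fin_numE//; apply: le_lt_trans (_ : m D < +oo)%E.
  apply: le_measure; rewrite ?inE//; first exact: mq.
by rewrite -ge0_fin_numE.
Qed.

HB.instance Definition _ := Measure_isFinite.Build _ _ _ im im_fin.

End image_measure_on.

(** * Regularity of finite Borel measures, reduced to open sets *)

Section regularity.
Context {R : realType} {d : Order.disp_t} {K : pointedOrderTopologicalType d}.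
Hypothesis cK : compact [set: K].
Variable mu : {finite_measure set (Borel K) -> \bar R}.

(** Continuity from above of a finite measure. It replaces a countable union of closed sets,
    possibly not closed, by a finite one. *)
Lemma finite_measure_tail (A : set (Borel K)) (C : nat -> set (Borel K)) (e e' : R) :
  measurable A -> (forall n, measurable (C n)) -> e < e' ->
  (mu (A `\` \bigcup_n C n) <= e%:E)%E ->
  exists N, (mu (A `\` \bigcup_(n in `I_N) C n) <= e'%:E)%E.
Proof.
move=> mA mC ee' H.
pose F N := A `\` \bigcup_(n in `I_N) C n.
have mF N : measurable (F N) by apply: measurableD => //; exact: bigcup_measurable.
have FE : \bigcap_N F N = A `\` \bigcup_n C n.
  apply/seteqP; split => x.
    move=> Fx; split; first by have [] := Fx 0%N I.
    move=> [n _ Cx]; have [_] := Fx n.+1 I; apply; exists n => //=.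
  by move=> [Ax nC] N _; split => // -[n _ Cn]; apply: nC; exists n.
have cF : (mu \o F) x @[x --> \oo] --> mu (\bigcap_N F N).
  apply: nonincreasing_cvg_mu => //.
  - by rewrite -ge0_fin_numE// fin_num_measure.
  - by rewrite FE; apply: measurableD => //; exact: bigcup_measurable.
  - move=> n k nk; apply/subsetPset => x [Ax nC]; split => // -[l /= ln Cl].
    by apply: nC; exists l => //=; exact: leq_trans nk.
have : nbhs (mu (\bigcap_N F N)) [set y | (y < e'%:E)%E].
  apply: open_nbhs_nbhs; split; first exact: open_ereal_lt_ereal.
  by rewrite FE /=; apply: le_lt_trans H _; rewrite lte_fin.
by move=> /cF[N _ HN]; exists N; apply: ltW; exact: (HN N (leqnn N)).
Qed.

(** Complementation exchanges the roles of [C] and [U], so this class is a sigma-algebra once it is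
    closed under countable unions. *)
Definition squeezed (A : set (Borel K)) := measurable A /\
  forall e : R, 0 < e -> exists C U : set K,
    [/\ closed C, open U, C `<=` A, A `<=` U & (mu (U `\` C) <= e%:E)%E].

(** The errors of the separate approximations sum to [e / 2]; the other half pays for keeping only
    finitely many of the closed sets. *)
Lemma squeezed_bigcup (A : nat -> set (Borel K)) :
  (forall n, squeezed (A n)) -> squeezed (\bigcup_n A n).
Proof.
move=> sA; split; first by apply: bigcup_measurable => n _; case: (sA n).
move=> e e0; have e2 : 0 < e / 2 by rewrite divr_gt0.
have /choice[CU H] n : exists CU : set K * set K,
    [/\ closed CU.1, open CU.2, CU.1 `<=` A n, A n `<=` CU.2 &
        (mu (CU.2 `\` CU.1) <= (e / 2 / (2 ^ n.+1)%:R)%:E)%E].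
  have [_] := sA n => /(_ (e / 2 / (2 ^ n.+1)%:R)).
  by rewrite divr_gt0// ?ltr0n ?expn_gt0// => /(_ isT)[C [U H]]; exists (C, U).
have mC n : measurable ((CU n).1 : set (Borel K)).
  by apply: closed_Borel; have [] := H n.
have mU n : measurable ((CU n).2 : set (Borel K)).
  by apply: open_Borel; have [] := H n.
pose U : set (Borel K) := \bigcup_n (CU n).2.
have mUU : measurable U by exact: bigcup_measurable.
have [] := @finite_measure_tail U (fun n => (CU n).1) (e / 2) e mUU mC.
- by lra.
- apply: le_trans (epsilon_trick0 xpredT (ltW e2)).
  apply: le_trans (_ : \big[+%E/0%R]_(0 <= n <oo) mu ((CU n).2 `\` (CU n).1) <= _)%E.
    apply: measure_sigma_subadditive.
    + by move=> n; exact: measurableD.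
    + by apply: measurableD => //; exact: bigcup_measurable.
    + move=> x [[n _ Ux] nC]; exists n => //; split => // Cx; apply: nC.
      by exists n.
  by apply: lee_nneseries => // n _ ; have [] := H n.
move=> N HN; exists (\bigcup_(n in `I_N) (CU n).1), U; split => //.
- by apply: closed_bigcup => // n _; have [] := H n.
- by apply: bigcup_open => n _; have [] := H n.
- by move=> x [n _ Cx]; exists n => //; have [_ _ + _ _] := H n; apply.
- by move=> x [n _ Ax]; exists n => //; have [_ _ _ + _] := H n; apply.
Qed.

(** Squeezed sets form a sigma-algebra, so it suffices to squeeze open sets, and only from inside. A
    null set is discarded because an open set of [K] need not be a countable union of closed
    sets. *)
Lemma regular_of_open :
  (forall U : set K, open U -> exists C : nat -> set K,
     (forall n, closed (C n) /\ C n `<=` U) /\ mu (U `\` \bigcup_n C n) = 0%E) ->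
  regular_measure mu.
Proof.
move=> openC.
have sq (A : set (Borel K)) : measurable A -> squeezed A.
  move: A; apply: smallest_sub; first split.
  - split => // e e0; exists set0, set0; split => //.
    + exact: closed0.
    + exact: open0.
    + by rewrite setD0 measure0 lee_fin ltW.
  - move=> A [mA sA]; split; first exact: measurableD.
    move=> e e0; have [C [U [cC oU CA AU mUC]]] := sA e e0.
    exists (~` U), (~` C); split.
    + exact: open_closedC.
    + exact: closed_openC.
    + by rewrite setTD; exact: subsetC.
    + by rewrite setTD; exact: subsetC.
    + by rewrite setDE setCK setIC -setDE.
  - exact: squeezed_bigcup.
  - move=> U oU; have mU := open_Borel oU; split => // e e0.
    have [C [HC mC0]] := openC U oU.
    have mC n : measurable (C n : set (Borel K)).
      by apply: closed_Borel; have [] := HC n.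
    have [|N HN] := @finite_measure_tail U C 0 e mU mC e0; first by rewrite mC0.
    exists (\bigcup_(n in `I_N) C n), U; split => //.
    + by apply: closed_bigcup => // n _; have [] := HC n.
    + by apply: bigcup_sub => n _; have [] := HC n.
move=> A mA; have [_ sA] := sq A mA.
have fA : mu A \is a fin_num by exact: fin_num_measure.
split; apply/eqP; rewrite eq_le; apply/andP; split.
- apply/lee_addgt0Pr => e e0; have [C [U [cC oU CA AU mUC]]] := sA e e0.
  have mC := closed_Borel cC; have mU := open_Borel oU.
  apply: le_trans (_ : mu C + mu (U `\` C) <= _)%E.
    rewrite -measureU//; [|exact: measurableD|by rewrite setDIK].
    apply: le_measure; rewrite ?inE//.
      by apply: measurableU => //; exact: measurableD.
    by move=> x /AU Ux; have [Cx|nC] := pselect (C x); [left|right].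
  apply: leeD => //; apply: ereal_sup_ubound; exists C => //; split => //.
  exact: subclosed_compact cC cK _.
- apply: ge_ereal_sup => _ [C [cC CA] <-].
  have mC : measurable (C : set (Borel K)).
    by apply: closed_Borel; apply: compact_closed => //; exact: order_hausdorff.
  by apply: le_measure; rewrite ?inE.
- apply: le_ereal_inf_tmp => _ [U [oU AU] <-].
  by apply: le_measure; rewrite ?inE//; exact: open_Borel.
- apply/lee_addgt0Pr => e e0; have [C [U [cC oU CA AU mUC]]] := sA e e0.
  have mC := closed_Borel cC; have mU := open_Borel oU.
  apply: le_trans (_ : mu U <= _)%E.
    by apply: ereal_inf_lbound; exists U.
  apply: le_trans (_ : mu A + mu (U `\` C) <= _)%E; last exact: leeD.
  rewrite -{1}(setDUK AU) measureU//; [|exact: measurableD|by rewrite setDIK].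
  apply: leeD => //; apply: le_measure; rewrite ?inE//; [exact: measurableD..|].
  by move=> x [Ux nA]; split => // /CA.
Qed.

End regularity.

Lemma countType_enum (T : countType) :
  exists e : nat -> option T, forall x, exists n, e n = Some x.
Proof. by exists unpickle => x; exists (pickle x); exact: pickleK. Qed.

Section quantile_measure.
Context {R : realType} {d : Order.disp_t} {K : pointedOrderTopologicalType d}.
Hypothesis cK : compact [set: K].
Variable H : K -> R.
Hypotheses (H0 : forall t, 0 <= H t)
  (ndH : forall s t, (s <= t)%O -> H s <= H t) (rcH : Defs.right_continuous H).

(** Right continuity makes the infimum of the points [s] with [u <= H s] a minimum, which gives the
    Galois connection. *)
Lemma quantile_exists (M : K) : (forall t, (t <= M)%O) -> exists q : R -> K,
  forall u, 0 < u <= H M -> forall s, (q u <= s)%O = (u <= H s).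
Proof.
move=> MP.
suff /choice[q Hq] : forall u, exists x : K, 0 < u <= H M ->
    forall s, (x <= s)%O = (u <= H s) by exists q.
move=> u; have [/andP[u0 uH]|nu] := boolP (0 < u <= H M); last by exists point.
have [|x [xlb [xinf _]]] := compact_line_inf cK (A := [set s | u <= H s]).
  by exists M.
exists x => _ s; apply/idP/idP => [xs|]; last exact: xlb.
apply: le_trans (ndH xs); rewrite leNgt; apply/negP => Hxu.
have [|[v [xv Hv]]|xmax] := rcH x (e := u - H x); first by rewrite subr_gt0.
- have [a [ua av]] := xinf v xv.
  have := Hv a (xlb a ua) av; have := ler_norm (H a - H x).
  by move: ua => /=; lra.
- have := xmax M => /ndH; lra.
Qed.

Lemma regular_measure_of_distribution :
  exists mu : {finite_measure set (Borel K) -> \bar R},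
    regular_measure mu /\ forall t, fine (mu [set s : K | (s <= t)%O]) = H t.
Proof.
have [M MP] := compact_line_max cK.
have [q Hq] := quantile_exists MP.
pose D : set R := [set u | 0 < u <= H M].
have DE : D = `]0, H M]%classic by apply/seteqP; split => u; rewrite /D /= in_itv.
have mD : measurable D by rewrite DE; exact: measurable_itv.
have lD (b : R) : 0 <= b -> lebesgue_measure (`]0, b]%classic : set R) = b%:E.
  move=> b0; rewrite lebesgue_measure_itv /= lte_fin.
  by case: ltP => [_|b0']; rewrite ?sube0//; congr EFin; lra.
have finD : lebesgue_measure D \is a fin_num by rewrite DE lD.
have ndq u u' : D u -> D u' -> u <= u' -> (q u <= q u')%O.
  by move=> Du Du' uu'; rewrite Hq//; apply: le_trans uu' _; rewrite -Hq.
(* The levels [u > r] for which [U] contains the whole order interval [[q r, q u]]. They form an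
   interval of reals, hence a Borel set, and the rational [r] suffice to cover the preimage of an
   open [U]. *)
pose P (U : set K) (r : rat) : set R := [set u | [/\ D (ratr r), D u, ratr r < u &
  forall x, (q (ratr r) <= x)%O -> (x <= q u)%O -> U x]].
have PU (U : set K) r : P U r `<=` D `&` q @^-1` U.
  by move=> u [Dr Du ru HU]; split => //; apply: HU => //; apply: ndq => //; exact: ltW.
have UP (U : set K) : open U -> D `&` q @^-1` U = \bigcup_r P U r.
  move=> oU; apply/seteqP; split => [u [Du Uqu]|u [r _ /PU//]].
  have /andP[u0 uM] := Du.
  have Dr b r : 0 <= b -> ratr r \in `]b, u[ -> D (ratr r).
    rewrite in_itv /= => b0 /andP[br ru].
    by rewrite /D /= (le_lt_trans b0 br) (le_trans (ltW ru) uM).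
  have [[v vq]|nv] := pselect (exists v, (v < q u)%O).
    have [||u1 [u1q HU]] := @nbhs_left _ _ (q u) U; [|by exists v|].
      exact: open_nbhs_nbhs.
    (* Levels above [H u1] have quantiles above [u1], so a rational level between [H u1] and [u]
       works. *)
    have Hu1 : H u1 < u by rewrite ltNge -Hq// -ltNge.
    have [r Hr] := rat_in_itvoo Hu1.
    have DDr := Dr _ _ (H0 u1) Hr.
    move: Hr; rewrite in_itv /= => /andP[u1r ru].
    exists r => //; split => // x qx xq; apply: HU => //.
    by apply: lt_le_trans qx; rewrite ltNge Hq// -ltNge.
  (* Here [q u] is the minimum of [K], and every positive level below [u] has the same quantile. *)
  have [r Hr] := rat_in_itvoo u0.
  have DDr := Dr _ _ (lexx 0) Hr.
  move: Hr; rewrite in_itv /= => /andP[_ ru].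
  exists r => //; split => // x qx xq.
  suff -> : x = q u by [].
  apply/eqP; rewrite eq_le xq leNgt; apply/negP => xu.
  by apply: nv; exists x.
have mq : measurable_fun D (q : R -> Borel K).
  apply: (measurability (rT := Borel K) _ (erefl _)) => _ [U oU <-].
  rewrite UP//; apply: bigcupT_measurable_rat => r.
  apply: is_interval_measurable => u v [Dr Du ru HU] [_ Dv rv HV] w /andP[uw wv].
  have rw : ratr r < w by exact: lt_le_trans ru uw.
  have Dw : D w.
    move: Du Dv => /andP[u0 _] /andP[_ vM].
    by apply/andP; split; [exact: lt_le_trans uw|exact: le_trans vM].
  split => // x qx xw; apply: HV => //; apply: le_trans xw _; exact: ndq.
pose mu : {finite_measure set (Borel K) -> \bar R} :=
  image_measure_on (m := lebesgue_measure) mD finD mq.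
have muE A : mu A = lebesgue_measure (D `&` q @^-1` A) by [].
exists mu; split; last first.
  move=> t; rewrite muE (_ : _ `&` _ = `]0, H t]%classic) ?lD//.
  apply/seteqP; split => u /=; rewrite in_itv /=.
    by move=> [Du]; rewrite Hq// => ->; case/andP: Du => ->.
  move=> /andP[u0 ut]; have Du : D u by rewrite /D /= u0 (le_trans ut)// ndH.
  by rewrite Hq.
apply: (regular_of_open cK) => U oU.
(* The closed interval between the quantiles of two rational levels, if it lies in [U] by virtue of
   [P]; otherwise the empty set. *)
pose B (p : rat * rat) : set K := [set x | P U p.1 (ratr p.2) /\
  ((q (ratr p.1) <= x)%O /\ (x <= q (ratr p.2))%O)].
have [enum enumP] := countType_enum (rat * rat)%type.
pose C n : set K := if enum n is Some p then B p else set0.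
have CP n : closed (C n) /\ C n `<=` U.
  rewrite /C; case: (enum n) => [[r r']|]; last first.
    by split; [exact: closed0|].
  rewrite /B /=; split; last by move=> x [[_ _ _ HU] [rx xr]]; exact: HU.
  have [Pr|nPr] := pselect (P U r (ratr r')).
    rewrite (_ : mkset _ = [set` `[q (ratr r), q (ratr r')]%O]).
      exact: itv_closed.
    apply/seteqP; split => x /=; rewrite in_itv /=.
      by move=> [_ [-> ->]].
    by move=> /andP[].
  rewrite (_ : mkset _ = set0); first exact: closed0.
  by rewrite -subset0 => x [].
exists C; split => //.
(* A level [u] of [P U r] below the supremum is followed by a rational [r'] and then by another
   level of [P U r], so [q u] lies in the closed interval [[q r, q r']] inside [U]. Only the
   countably many suprema can be missed. *)
pose E := range (fun r : rat => sup (P U r)).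
have cE : countable E by apply: (sub_countable (card_image_le _ _)); exact: countableP.
have mE : measurable E by apply: countable_measurable.
have sub : D `&` q @^-1` (U `\` \bigcup_n C n) `<=` E.
  move=> u [Du [/= Uqu nC]].
  have : (D `&` q @^-1` U) u by [].
  rewrite UP// => -[r _ Pu]; exists r => //.
  have supP : has_sup (P U r).
    split; first by exists u.
    by exists (H M) => v [_ /andP[]].
  apply/eqP; rewrite eq_le; apply/andP; split; last exact: sup_upper_bound.
  rewrite leNgt; apply/negP => ultsup.
  have [v Pv uv] := sup_gt (S := P U r) (ex_intro _ u Pu) ultsup.
  have [r' ] := rat_in_itvoo uv; rewrite in_itv /= => /andP[ur' r'v].
  have [Dr _ ru _] := Pu; have [_ Dv rv HV] := Pv.
  have Dr' : D (ratr r').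
    move: Du Dv => /andP[u0 _] /andP[_ vM].
    by apply/andP; split; [exact: lt_trans ur'|exact: le_trans (ltW r'v) vM].
  have [n En] := enumP (r, r').
  apply: nC; exists n => //; rewrite /C En; split => /=.
    split => //; first exact: lt_trans ur'.
    move=> x rx xr'; apply: HV => //; apply: le_trans xr' _; apply: ndq => //.
    exact: ltW.
  by split; apply: ndq => //; exact: ltW.
apply/eqP; rewrite eq_le measure_ge0 andbT muE.
rewrite -(countable_lebesgue_measure0 cE).
apply: le_measure; rewrite ?inE//.
apply: (mq mD); apply: measurableD; first exact: open_Borel.
apply: bigcup_measurable => n _; apply: closed_Borel.
by have [] := CP n.
Qed.

End quantile_measure.

(** * Fibers and the necessary condition *)

Section fibers.
Context {dK dL : Order.disp_t} {K : pointedOrderTopologicalType dK}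
  {L : pointedOrderTopologicalType dL}.
Variable phi : K -> L.
Hypotheses (cK : compact [set: K]) (cphi : continuous phi)
  (mphi : {homo phi : x y / (x <= y)%O}).

(** [lo] and [hi] are the left and right adjoints of [phi]; in this form comparisons in [K] and in
    [L] translate by rewriting. *)
Lemma fiber_ends : (forall t, exists s, phi s = t) -> exists lo hi : L -> K,
  (forall s t, (lo t <= s)%O = (t <= phi s)%O) /\
  (forall s t, (s <= hi t)%O = (phi s <= t)%O).
Proof.
move=> sphi.
have clf t : closed [set s | phi s = t].
  rewrite (_ : mkset _ = phi @^-1` [set` `[t, t]%O]).
    by move/continuous_closedP : cphi; apply; exact: itv_closed.
  apply/seteqP; split => s /=; rewrite in_itv /=; first by move=> ->; rewrite lexx.
  by move=> H; apply/eqP; rewrite eq_le andbC.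
have /choice[lo Hlo] t : exists x, phi x = t /\ forall s, phi s = t -> (x <= s)%O.
  have [|x [xl [_ Cx]]] := compact_line_inf cK (A := [set s | phi s = t]).
    exact: sphi.
  by exists x; split => //; exact: Cx.
have /choice[hi Hhi] t : exists x, phi x = t /\ forall s, phi s = t -> (s <= x)%O.
  have [|x [xl [_ Cx]]] := compact_line_sup cK (A := [set s | phi s = t]).
    exact: sphi.
  by exists x; split => //; exact: Cx.
exists lo, hi; split => s t.
- have [pl l] := Hlo t; apply/idP/idP => [/mphi|]; first by rewrite pl.
  rewrite le_eqVlt => /predU1P[/esym/l//|ts].
  by case: leP => // /ltW/mphi; rewrite pl leNgt ts.
- have [pl l] := Hhi t; apply/idP/idP => [/mphi|]; first by rewrite pl.
  rewrite le_eqVlt => /predU1P[/l//|ts].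
  by case: leP => // /ltW/mphi; rewrite pl leNgt ts.
Qed.

Variables lo hi : L -> K.
Hypotheses (loE : forall s t, (lo t <= s)%O = (t <= phi s)%O)
  (hiE : forall s t, (s <= hi t)%O = (phi s <= t)%O)
  (sphi : forall t, exists s, phi s = t).

Lemma phi_lo t : phi (lo t) = t.
Proof.
have [s <-] := sphi t; apply/eqP; rewrite eq_le -[X in _ && X]loE lexx andbT.
by apply: mphi; rewrite loE.
Qed.

Lemma phi_hi t : phi (hi t) = t.
Proof.
have [s <-] := sphi t; apply/eqP; rewrite eq_le -[X in X && _]hiE lexx /=.
by apply: mphi; rewrite hiE.
Qed.

Lemma lo_le_hi t : (lo t <= hi t)%O.
Proof. by rewrite loE phi_hi. Qed.

Lemma hi_lt_lo t t' : (t < t')%O -> (hi t < lo t')%O.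
Proof. by move=> tt'; rewrite ltNge loE phi_hi -ltNge. Qed.

Lemma QsetP t : Qset phi t <-> (lo t < hi t)%O.
Proof.
split; last first.
  move=> lh; exists (lo t), (hi t); split; last by rewrite phi_lo phi_hi.
  by move=> E; rewrite E ltxx in lh.
move=> [s1 [s2 [ne [p1 p2]]]]; rewrite lt_neqAle lo_le_hi andbT.
apply/negP => /eqP E; apply: ne.
have H s : phi s = t -> s = hi t.
  by move=> ps; apply/eqP; rewrite eq_le hiE ps lexx -E loE ps lexx.
by rewrite (H _ p1) (H _ p2).
Qed.

Lemma pushes_hi (R : realType) (G : K -> R) (F : L -> R) :
  pushes phi G F <-> forall t, F t = G (hi t).
Proof.
split=> [H t|H t s ps smax].
  by apply: H; [exact: phi_hi|move=> s ps; rewrite hiE ps].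
suff -> : s = hi t by [].
by apply/eqP; rewrite eq_le hiE ps lexx smax// phi_hi.
Qed.

End fibers.

(** The increment bridging the two lists is dropped. This adds up variations over successive
    fibers. *)
Lemma varsum_cat {R : realType} {d} {K : orderType d} (G : K -> R) x s y s' :
  varsum G (x :: s) + varsum G (y :: s') <= varsum G (x :: s ++ y :: s').
Proof.
elim: s x => [|z s IH] x /=.
  by rewrite {1}/varsum /= big_nil add0r {2}/varsum /= big_cons lerDr.
rewrite {1}/varsum [leRHS]/varsum /= !big_cons -addrA lerD2l.
exact: IH.
Qed.

Section necessity.
Context {R : realType} {dK dL : Order.disp_t}
  {K : pointedOrderTopologicalType dK} {L : pointedOrderTopologicalType dL}.
Variable phi : K -> L.
Hypotheses (cK : compact [set: K]) (cphi : continuous phi)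
  (mphi : {homo phi : x y / (x <= y)%O}) (sphi : forall t, exists s, phi s = t).
Variables (I : Type) (F : I -> L -> R).

(** Everywhere [(1 - f) * (ray q - ray p) = ray q - f], so [G q] minus the integral of [f] is a
    Riemann-Stieltjes integral of [1 - f] over []p, q]]. The path is returned so that it can be
    concatenated with those of other fibers. *)
Lemma sintegral_fiber_le (mu1 mu2 : {finite_measure set (Borel K) -> \bar R})
    (G f : K -> R) (p q : K) (e : R) :
  associated G mu1 mu2 -> continuous f -> (forall x, 0 <= f x <= 1) ->
  (p <= q)%O -> (forall x, (x <= p)%O -> f x = 1) -> 0 < e ->
  (forall x, (q <= x)%O -> f x = 0) ->
  exists s, [/\ path <%O p s, last p s = q &
    `|G q - Defs.sintegral mu1 mu2 f| <= varsum G (p :: s) + e].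
Proof.
move=> aG cf f01 pq f1 e0 f0.
pose w x := 1 - f x.
have cw : continuous w by move=> x; apply: cvgB; [exact: cvg_cst|exact: cf].
have m0 := total_mass_ge0 mu1 mu2 setT.
set m := total_mass _ _ _ in m0.
have m1 : 0 < m + 1 by lra.
have [s [ps lq Hs]] := sintegral_rs cK aG cw (divr_gt0 e0 m1) pq.
exists s; split => //.
have wE : (fun x => w x * (ray q x - ray p x)) = (fun x => ray q x - f x).
  apply/funext => x; rewrite /w; have [xp|px] := leP x p.
    by rewrite !ray_le ?(le_trans xp)// f1//; lra.
  rewrite (ray_gt px); have [xq|qx] := leP x q; first by rewrite ray_le//; lra.
  by rewrite ray_gt// f0 ?(ltW qx)//; lra.
move: Hs; rewrite wE sintegralB; [|exact: bounded_borel_ray|]; last first.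
  exact: bounded_borel_continuous.
rewrite (sintegral_ray_assoc aG) -/m.
have : `|rs_sum w G p s| <= 1 * varsum G (p :: s).
  by apply: rs_sum_le => x; have := f01 x; rewrite /w ler_norml; lra.
have : e / (m + 1) * m <= e.
  by rewrite mulrAC ler_pdivrMr// ler_wpM2l//; lra.
rewrite mul1r !ler_norml; lra.
Qed.

Lemma extends_through_c0l1 : extends_through phi F -> c0l1 (Qset phi) F.
Proof.
move=> [G [wG pG]].
have [B HB] := wstar_null_bounded cK wG.
case: wG => _ [mu1 [mu2 [Hmu null]]].
have [lo [hi [loE hiE]]] := fiber_ends cK cphi mphi sphi.
have loP := phi_lo mphi loE sphi; have hiP := phi_hi mphi hiE sphi.
have loi := lo_le_hi mphi loE hiE sphi.
have QP := QsetP mphi loE hiE sphi.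
have FE i t : F i t = G i (hi t) by move: t; apply/(pushes_hi mphi hiE sphi).
(* One [f t] serves all [i], so nullity applies to [a i t]; for a trivial fiber the value 0 is a
   default. *)
have /choice[f Hf] t : exists f : K -> R, (lo t < hi t)%O ->
    [/\ continuous f, forall x, 0 <= f x <= 1, forall x, (x <= lo t)%O -> f x = 1
      & forall x, (hi t <= x)%O -> f x = 0].
  have [lh|nlh] := boolP (lo t < hi t)%O; last by exists (fun=> 0).
  have [w [cw w01 w0 w1]] := compact_line_urysohn cK R lh.
  exists (fun x => 1 - w x) => _; split.
  - by move=> x; apply: cvgB; [exact: cvg_cst|exact: cw].
  - by move=> x; have := w01 x; lra.
  - by move=> x /w0 ->; rewrite subr0.
  - by move=> x /w1 ->; rewrite subrr.
pose a i t := Defs.sintegral (mu1 i) (mu2 i) (f t).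
exists a, (fun i t => F i t - a i t); split; [|split].
- by move=> i t _; rewrite addrC subrK.
- by move=> t /QP/Hf[cf _ _ _]; exact: null.
(* [B] bounds the variation sums of [G i], and 1 absorbs the errors of the finitely many fiber
   estimates. *)
exists (B + 1) => i; apply: ge_ereal_sup => _ [A [finA AQ] <-].
have [s0 As] := (finite_seqP A).1 finA.
pose ts := sort <=%O (undup s0).
have uts : uniq ts by rewrite sort_uniq undup_uniq.
have Ats : A = [set` ts].
  by rewrite As; apply/seteqP; split => t /=; rewrite mem_sort mem_undup.
have sts : sorted <%O ts by rewrite sort_lt_sorted undup_uniq.
have Qts t : t \in ts -> Qset phi t by move=> tts; apply: AQ; rewrite Ats.
rewrite Ats -fsbig_seq// sumEFin lee_fin.
(* Induction over the sorted fibers, the tolerance being halved each time; the paths concatenate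
   because [hi t < lo u]. *)
have claim t s e : 0 < e -> path <%O t s -> (forall t', t' \in t :: s -> Qset phi t') ->
    exists s', path <%O (lo t) s' /\
     \sum_(t' <- t :: s) `|F i t' - a i t'| <= varsum (G i) (lo t :: s') + e.
  have [_ [_ aG]] := Hmu i.
  elim: s t e => [|u s IH] t e e0 /=.
    move=> _ /(_ t (mem_head _ _))/QP lh; have [cf f01 f1 f0] := Hf t lh.
    have [s' [ps' _ H]] := sintegral_fiber_le aG cf f01 (ltW lh) f1 e0 f0.
    by exists s'; rewrite big_seq1 FE.
  move=> /andP[tu us] Qs.
  have e2 : 0 < e / 2 by rewrite divr_gt0.
  have [|s2 [ps2 H2]] := IH u (e / 2) e2 us.
    by move=> t' t's; apply: Qs; rewrite inE t's orbT.
  have /QP lh : Qset phi t by apply: Qs; rewrite mem_head.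
  have [cf f01 f1 f0] := Hf t lh.
  have [s1 [ps1 l1 H1]] := sintegral_fiber_le aG cf f01 (ltW lh) f1 e2 f0.
  exists (s1 ++ lo u :: s2); split.
    by rewrite cat_path ps1 /= l1 ps2 andbT; exact: (hi_lt_lo mphi loE hiE sphi).
  rewrite big_cons FE; have := varsum_cat (G i) (lo t) s1 (lo u) s2.
  rewrite /a; move: H1 H2; rewrite /a; lra.
case: ts sts Qts {uts Ats} => [|t s] sts Qts.
  rewrite big_nil; have := HB i; case => /(_ (lo point)) H _.
  by have := le_trans (normr_ge0 _) H; lra.
have [s' [ps' H]] := claim t s 1 ltr01 sts Qts.
by apply: le_trans H _; rewrite lerD2r; have [_] := HB i; apply.
Qed.

End necessity.

(** * Interpolation and jump functions *)

Section interpolation.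
Context {R : realType}.

Lemma c0limD (I : Type) (a b : I -> R) : c0lim a -> c0lim b ->
  c0lim (fun i => a i + b i).
Proof.
move=> ca cb e e0; have e2 : 0 < e / 2 by rewrite divr_gt0.
have : finite_set ([set i | e / 2 <= `|a i|] `|` [set i | e / 2 <= `|b i|]).
  by rewrite finite_setU; split; [exact: ca|exact: cb].
apply: sub_finite_set => i /= H.
have [ai|ai] := leP (e / 2) `|a i|; first by left.
right; have := ler_normD (a i) (b i); rewrite /=; lra.
Qed.

Lemma c0limZ (I : Type) (c : R) (a : I -> R) : c0lim a ->
  c0lim (fun i => c * a i).
Proof.
move=> ca e e0; have c1 : 0 < `|c| + 1 by have := normr_ge0 c; lra.
apply: sub_finite_set (ca (e / (`|c| + 1)) (divr_gt0 e0 c1)) => i /=.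
rewrite normrM ler_pdivrMr// => H; apply: le_trans H _.
by rewrite mulrC ler_wpM2l//; lra.
Qed.

Lemma c0lim_approx (I : Type) (a : I -> R) :
  (forall e, 0 < e -> exists h, c0lim h /\ forall i, `|a i - h i| <= e) ->
  c0lim a.
Proof.
move=> H e e0; have e2 : 0 < e / 2 by rewrite divr_gt0.
have [h [ch ah]] := H _ e2.
apply: sub_finite_set (ch _ e2) => i /= ai.
have := ler_normD (a i - h i) (h i); rewrite subrK; have := ah i; lra.
Qed.

Context {d : Order.disp_t} {K : pointedOrderTopologicalType d}.
Hypothesis cK : compact [set: K].

(** A telescoping approximation of [f - f u]. The functions [w] are a parameter because their choice
    depends on whether the two points share a fiber. *)
Fixpoint interpolation (w : K -> K -> K -> R) (f : K -> R) u s : K -> R :=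
  if s is y :: s' then
    fun x => (f y - f u) * w u y x + interpolation w f y s' x
  else fun=> 0.

Variable w : K -> K -> K -> R.
Hypothesis w01 : forall u v, (u < v)%O ->
  [/\ continuous (w u v), forall x, 0 <= w u v x <= 1,
      forall x, (x <= u)%O -> w u v x = 0 & forall x, (v <= x)%O -> w u v x = 1].
Implicit Types (f : K -> R) (u v x : K) (s : seq K).

Lemma continuous_interpolation f u s : path <%O u s ->
  continuous (interpolation w f u s).
Proof.
elim: s u => [|y s IH] u /=; first by move=> _; exact: cst_continuous.
move=> /andP[uy ys]; apply: continuousDr; last exact: IH.
by apply: continuousZr; have [] := w01 uy.
Qed.

Lemma interpolation_le f u s x : path <%O u s -> (x <= u)%O ->
  interpolation w f u s x = 0.
Proof.
elim: s u => //= y s IH u /andP[uy ys] xu.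
have [_ _ w0 _] := w01 uy.
by rewrite w0// mulr0 add0r IH// (le_trans xu)// ltW.
Qed.

Lemma interpolation_approx f (e : R) u s x : 0 <= e -> path (slow f e) u s ->
  (u <= x)%O -> (x <= last u s)%O -> `|f x - f u - interpolation w f u s x| <= e.
Proof.
move=> e0; elim: s u => [|y s IH] u /=.
  move=> _ ux xu; have -> : x = u by apply/eqP; rewrite eq_le xu.
  by rewrite subrr subr0 normr0.
move=> /andP[/andP[uy /asboolP fuy] ys] ux xl.
have [_ w1 w0 wy] := w01 uy.
have [yx|xy] := leP y x.
  rewrite wy// mulr1; have := IH y ys yx xl.
  by congr (`| _ | <= _); lra.
rewrite (interpolation_le f (path_slow_lt ys) (ltW xy)) addr0.
move: ux; rewrite le_eqVlt => /predU1P[<-|ux].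
  by rewrite w0// mulr0 !subrr normr0.
have [] := fuy x ux xy; have := w1 x.
move: (w u y x) => z /andP[z0 z1].
rewrite !ler_norml => /andP[h1 h2] /andP[h3 h4].
(* The error is a convex combination of the two differences controlled by [slow]. *)
have -> : f x - f u - (f y - f u) * z = (1 - z) * (f x - f u) + z * (f x - f y).
  by lra.
apply/andP; split; nra.
Qed.

Lemma c0lim_interpolation (I : Type) (J : I -> (K -> R) -> R) (f : K -> R) u s :
  (forall i (f g : K -> R), continuous f -> continuous g ->
    J i (fun x => f x + g x) = J i f + J i g) ->
  (forall i (c : R) (f : K -> R), continuous f -> J i (fun x => c * f x) = c * J i f) ->
  (forall u v, (u < v)%O -> c0lim (fun i => J i (w u v))) ->
  path <%O u s -> c0lim (fun i => J i (interpolation w f u s)).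
Proof.
move=> JD JZ Jw; elim: s u => [|y s IH] u /=.
  move=> _ e e0; rewrite (_ : mkset _ = set0); first exact: finite_set0.
  rewrite -subset0 => i /=.
  have -> : J i (fun=> 0) = 0.
    have ccst : continuous ((fun=> 0) : K -> R) by exact: cst_continuous.
    have := JZ i 0 _ ccst.
    by under eq_fun do rewrite mul0r; rewrite mul0r.
  by rewrite normr0 leNgt e0.
move=> /andP[uy ys]; have [cw _ _ _] := w01 uy.
rewrite (_ : (fun i => _) =
    (fun i => (f y - f u) * J i (w u y) + J i (interpolation w f y s))); last first.
  apply/funext => i; rewrite JD ?JZ//; first exact: continuousZr.
  exact: continuous_interpolation.
apply: c0limD; last exact: IH.
by apply: c0limZ; exact: Jw.
Qed.

End interpolation.

Section jump_functions.
Context {R : realType} {L : choiceType}.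
Variables (Q : set L) (w : L -> R) (C : R).
Hypotheses (w0 : forall t, 0 <= w t)
  (wC : (\esum_(t in Q) (w t)%:E <= C%:E)%E).

Definition jump_mass (A : set L) : R := fine (\esum_(t in Q `&` A) (w t)%:E).

Let w0' t : (0 <= (w t)%:E)%E. Proof. by rewrite lee_fin. Qed.

Let esum_fin (A : set L) : \esum_(t in Q `&` A) (w t)%:E \is a fin_num.
Proof.
rewrite ge0_fin_numE; last by apply: esum_ge0 => t _.
apply: le_lt_trans (_ : C%:E < +oo)%E; last by rewrite ltry.
apply: le_trans wC; rewrite (esumID A Q); last by move=> t _.
by rewrite leeDl// esum_ge0.
Qed.

Lemma jump_mass_ge0 A : 0 <= jump_mass A.
Proof. by rewrite /jump_mass fine_ge0// esum_ge0. Qed.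

Lemma jump_massID (B A : set L) :
  jump_mass A = jump_mass (A `&` B) + jump_mass (A `&` ~` B).
Proof.
rewrite /jump_mass (esumID B (Q `&` A)); last by move=> t _.
by rewrite !setIA fineD// -setIA esum_fin.
Qed.

Lemma jump_mass_sub (A B : set L) : A `<=` B -> jump_mass A <= jump_mass B.
Proof.
move=> AB; rewrite (jump_massID A B) (_ : B `&` A = A); last exact: setIidr.
by rewrite lerDl jump_mass_ge0.
Qed.

Lemma jump_mass_le A : jump_mass A <= C.
Proof.
rewrite -lee_fin /jump_mass fineK ?esum_fin//.
apply: le_trans wC; rewrite (esumID A Q); last by move=> t _.
by rewrite leeDl// esum_ge0.
Qed.

Lemma jump_mass1 t : Q t -> jump_mass [set t] = w t.
Proof.
move=> Qt; rewrite /jump_mass (_ : _ `&` _ = [set t]) ?esum_set1//.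
by apply/seteqP; split => [s [_ ->]//|s ->].
Qed.

Lemma jump_mass0 A : (forall t, A t -> ~ Q t) -> jump_mass A = 0.
Proof.
move=> AQ; rewrite /jump_mass (_ : _ `&` _ = set0) ?esum_set0//.
by rewrite -subset0 => t [Qt /AQ].
Qed.

Lemma jump_mass_tail (e : R) : 0 < e ->
  exists l : seq L, jump_mass (~` [set` l]) < e.
Proof.
move=> e0.
have fQ : \esum_(t in Q) (w t)%:E \is a fin_num by rewrite -(setIT Q) esum_fin.
have [_ [A [finA AQ] <-] HA] := ub_ereal_sup_adherent e0 fQ.
have [l Al] := (finite_seqP A).1 finA.
exists l; rewrite -Al -lte_fin /jump_mass fineK ?esum_fin//.
move: HA; rewrite -/(esum Q _) (esumID A Q) //.
rewrite (_ : Q `&` A = A); last exact: setIidr.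
rewrite esum_fset//.
have fA : (\sum_(x \in A) (w x)%:E)%E \is a fin_num.
  rewrite -esum_fset// -(setIidr AQ); exact: esum_fin.
rewrite -(fineK (esum_fin _)) -(fineK fA).
set a := fine _; set b := fine _; rewrite -EFinD !lte_fin; lra.
Qed.

Context {d : Order.disp_t} {K : pointedOrderTopologicalType d}.
Variable p : L -> K.

(** The distribution function of the atomic measure with mass [w t] at [p t] for [t] in [Q]. *)
Definition jump_fun (s : K) : R := jump_mass [set t | (p t <= s)%O].

Lemma jump_fun_nd s t : (s <= t)%O -> jump_fun s <= jump_fun t.
Proof. by move=> st; apply: jump_mass_sub => x /= /le_trans; apply. Qed.

(** Finitely many indices carry all but [e] of the mass. With [u] at or before each of their points
    beyond [s], the increments on [[s, u[] come from the remaining indices. *)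
Lemma jump_fun_rc : Defs.right_continuous jump_fun.
Proof.
move=> s e e0.
have [smax|nmax] := pselect (forall t, (t <= s)%O); [by right|left].
have [v sv] : exists v, (s < v)%O.
  apply: contrapT => nv; apply: nmax => t; rewrite leNgt; apply/negP => st.
  by apply: nv; exists t.
have [l Hl] := jump_mass_tail e0.
have [u [su Hu]] : exists u, (s < u)%O /\
    forall t, t \in l -> (s < p t)%O -> (u <= p t)%O.
  elim: (l) => [|t l' [u [su Hu]]]; first by exists v.
  have [spt|pts] := ltP s (p t); last first.
    exists u; split => // t'; rewrite inE => /predU1P[->|/Hu//].
    by rewrite ltNge pts.
  exists (Order.min u (p t)); split; first by rewrite lt_min su.
  move=> t'; rewrite inE => /predU1P[->|/Hu H /H H'].
    by rewrite ge_min lexx orbT.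
  by rewrite ge_min H'.
exists u; split => // x sx xu.
rewrite ger0_norm ?subr_ge0 ?jump_fun_nd//; apply: le_lt_trans Hl.
rewrite /jump_fun (jump_massID [set t | (p t <= s)%O] [set t | (p t <= x)%O]).
rewrite (_ : _ `&` _ = [set t | (p t <= s)%O]); last first.
  by apply/setIidr => t /= /le_trans; apply.
rewrite addrC addKr; apply: jump_mass_sub => t [/= ptx npts] tl.
have : (u <= p t)%O by apply: Hu => //; rewrite ltNge; exact/negP.
by rewrite leNgt (le_lt_trans ptx xu).
Qed.

End jump_functions.

(** * Right continuity, and variation under composition with [phi] *)

Section right_continuity.
Context {R : realType} {d : Order.disp_t} {K : pointedOrderTopologicalType d}.
Implicit Types f g : K -> R.

Lemma right_continuousD f g : Defs.right_continuous f ->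
  Defs.right_continuous g -> Defs.right_continuous (fun x => f x + g x).
Proof.
move=> rf rg t e e0; have e2 : 0 < e / 2 by rewrite divr_gt0.
have [[u [tu Hu]]|] := rf t _ e2; last by right.
have [[v [tv Hv]]|] := rg t _ e2; last by right.
left; exists (Order.min u v); split; first by rewrite lt_min tu.
move=> s ts; rewrite lt_min => /andP[su sv].
have := Hu s ts su; have := Hv s ts sv; rewrite !ltr_norml; lra.
Qed.

Lemma right_continuousN f : Defs.right_continuous f ->
  Defs.right_continuous (fun x => - f x).
Proof.
move=> rf t e e0; have [[u [tu Hu]]|] := rf t _ e0; last by right.
left; exists u; split => // s ts su.
by rewrite -opprD normrN; exact: Hu.
Qed.

Lemma varsum_nd (H : K -> R) x s : (forall s t, (s <= t)%O -> H s <= H t) ->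
  path <%O x s -> varsum H (x :: s) = H (last x s) - H x.
Proof.
move=> ndH; elim: s x => [|y s IH] x /=; first by rewrite varsum1 subrr.
move=> /andP[xy ys]; rewrite varsum_cons2 IH// ger0_norm; last first.
  by rewrite subr_ge0 ndH// ltW.
by rewrite addrC addrA subrK.
Qed.

Lemma varsumB f g s : varsum (fun x => f x - g x) s <= varsum f s + varsum g s.
Proof.
rewrite /varsum -big_split /=; apply: ler_sum => -[x y] _ /=.
rewrite (_ : f y - g y - (f x - g x) = (f y - f x) - (g y - g x)); last by lra.
exact: ler_normB.
Qed.

Context {dL : Order.disp_t} {L : pointedOrderTopologicalType dL}.
Variable phi : K -> L.
Hypotheses (cphi : continuous phi) (mphi : {homo phi : x y / (x <= y)%O}).

(** Steps inside a fiber contribute nothing and are deleted. *)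
Lemma varsum_comp (F : L -> R) x s : path <%O x s ->
  exists s', path <%O (phi x) s' /\
    varsum (fun z => F (phi z)) (x :: s) = varsum F (phi x :: s').
Proof.
elim: s x => [|y s IH] x /=; first by exists [::]; rewrite !varsum1.
move=> /andP[xy ys]; have [s' [ps' E]] := IH y ys.
rewrite varsum_cons2 E.
have := mphi (ltW xy); rewrite le_eqVlt => /predU1P[pxy|pxy].
  by exists s'; rewrite pxy subrr normr0 add0r.
by exists (phi y :: s'); rewrite varsum_cons2 /= pxy.
Qed.

(** Outer regularity at [phi s] gives a point [u'], and continuity keeps [phi x < u'] for [x]
    slightly to the right of [s]. *)
Lemma right_continuous_distribution
    (nu : {finite_measure set (Borel L) -> \bar R}) : regular_measure nu ->
  Defs.right_continuous (fun s => fine (nu [set t | (t <= phi s)%O])).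
Proof.
move=> rnu s e e0.
have nd x y : (x <= y)%O ->
    fine (nu [set t | (t <= phi x)%O]) <= fine (nu [set t | (t <= phi y)%O]).
  move=> xy; apply: fine_le; rewrite ?fin_num_measure//; do ?exact: lray_Borel.
  apply: le_measure; rewrite ?inE; do ?exact: lray_Borel.
  by move=> t /= /le_trans; apply; exact: mphi.
have [smax|nmax] := pselect (forall t, (t <= s)%O); [by right|left].
have [v sv] : exists v, (s < v)%O.
  apply: contrapT => nv; apply: nmax => t; rewrite leNgt; apply/negP => st.
  by apply: nv; exists t.
(* If [phi s] is the maximum of [L], then [phi] is constant from [s] on. *)
have [[v' sv']|nv'] := pselect (exists v', (phi s < v')%O); last first.
  exists v; split => // x sx xv.
  suff -> : phi x = phi s by rewrite subrr normr0.
  apply/eqP; rewrite eq_le (mphi sx) andbT leNgt; apply/negP => H.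
  by apply: nv'; exists (phi x).
have [u' [su' u'v' Hu']] := regular_lray_rc rnu sv' (divr_gt0 e0 (ltr0n R 2)).
have [||u [su Hu]] := @nbhs_right _ _ s (phi @^-1` [set` `]-oo, u'[%O]); [|by exists v|].
  apply: open_nbhs_nbhs; split; last by rewrite /= in_itv.
  by move/continuousP : cphi; apply; exact: lray_open.
exists u; split => // x sx xu.
rewrite ger0_norm ?subr_ge0 ?nd//.
apply: le_lt_trans (_ : e / 2 < e); last by lra.
rewrite lerBlDl; apply: le_trans Hu'.
have mu' : measurable ([set t : L | (t < u')%O] : set (Borel L)).
  apply: open_Borel; rewrite (_ : mkset _ = [set` `]-oo, u'[%O]).
    exact: lray_open.
  by apply/seteqP; split => t /=; rewrite in_itv.
have ml := lray_Borel (phi x).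
apply: fine_le; rewrite ?fin_num_measure//.
apply: le_measure; rewrite ?inE// => t /= /le_lt_trans; apply.
by have := Hu x sx xu; rewrite /= in_itv.
Qed.

End right_continuity.

(** * Construction of the extension *)

Section lift.
Context {R : realType} {dK dL : Order.disp_t}
  {K : pointedOrderTopologicalType dK} {L : pointedOrderTopologicalType dL}.
Variables (phi : K -> L) (lo hi : L -> K).
Hypotheses (cK : compact [set: K]) (cL : compact [set: L])
  (cphi : continuous phi)
  (mphi : {homo phi : x y / (x <= y)%O}) (sphi : forall t, exists s, phi s = t)
  (loE : forall s t, (lo t <= s)%O = (t <= phi s)%O)
  (hiE : forall s t, (s <= hi t)%O = (phi s <= t)%O).

Notation Q := (Qset phi).

(** Adding the weights before bounding gives [C] rather than [2 C]; it is applied to the positive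
    and negative parts of [b]. *)
Lemma jump_mass_addl (w1 w2 : L -> R) (C : R) (A : set L) :
  (forall t, 0 <= w1 t) -> (forall t, 0 <= w2 t) ->
  (\esum_(t in Q) (w1 t + w2 t)%:E <= C%:E)%E ->
  jump_mass Q w1 A + jump_mass Q w2 A <= C.
Proof.
move=> w10 w20 wC.
have w120 t : 0 <= w1 t + w2 t by rewrite addr_ge0.
apply: le_trans (jump_mass_le w120 wC A).
have H (w : L -> R) : (forall t, 0 <= w t) -> (forall t, w t <= w1 t + w2 t) ->
    \esum_(t in Q `&` A) (w t)%:E \is a fin_num.
  move=> w0 ww; rewrite ge0_fin_numE; last first.
    by apply: esum_ge0 => t _; rewrite lee_fin.
  apply: le_lt_trans (_ : C%:E < +oo)%E; last by rewrite ltry.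
  apply: le_trans wC; rewrite [leRHS](esumID A Q); last by move=> t _; rewrite lee_fin.
  apply: le_trans (_ : \esum_(t in Q `&` A) (w1 t + w2 t)%:E <= _)%E.
    by apply: le_esum => t _; rewrite lee_fin.
  by rewrite leeDl// esum_ge0// => t _; rewrite lee_fin.
rewrite /jump_mass -fineD.
- rewrite -esumD; [|by move=> t _; rewrite lee_fin..].
  by [].
- by apply: H => // t; rewrite lerDl.
- by apply: H => // t; rewrite lerDr.
Qed.

(** An index counted at [lo] but not yet at [hi] satisfies [lo t <= s < hi t], which forces
    [t = phi s]. *)
Lemma jump_fun_lo_hi (w : L -> R) (C : R) s : (forall t, 0 <= w t) ->
  (\esum_(t in Q) (w t)%:E <= C%:E)%E ->
  jump_fun Q w lo s - jump_fun Q w hi s =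
    if (s < hi (phi s))%O then w (phi s) else 0.
Proof.
move=> w0 wC.
have loi := lo_le_hi mphi loE hiE sphi.
rewrite /jump_fun (jump_massID w0 wC [set t | (hi t <= s)%O] [set t | (lo t <= s)%O]).
rewrite (_ : _ `&` _ = [set t | (hi t <= s)%O]); last first.
  by apply/setIidr => t /=; exact: le_trans.
rewrite addrC addKr.
have H t : (lo t <= s)%O -> ~ (hi t <= s)%O -> t = phi s.
  rewrite loE => ts nh; apply/eqP; rewrite eq_le ts leNgt; apply/negP => lts.
  apply: nh; apply: ltW; apply: lt_le_trans (hi_lt_lo mphi loE hiE sphi lts) _.
  by rewrite loE.
case: ltP => hs.
  have Qs : Q (phi s).
    by apply/(QsetP mphi loE hiE sphi); apply: le_lt_trans hs; rewrite loE.
  rewrite -(jump_mass1 w0 Qs); congr jump_mass.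
  apply/seteqP; split => t /=; first by move=> [/H].
  by move=> ->; rewrite loE; split => //; apply/negP; rewrite -ltNge.
apply: jump_mass0 => t [/= lts nh]; have E := H t lts nh.
by case: nh; rewrite E.
Qed.

Section one_function.
Variables (F b : L -> R) (k : R).
Hypothesis bk : (\esum_(t in Q) (`|b t|)%:E <= k%:E)%E.

Let bp t := (`|b t| + b t) / 2.
Let bm t := (`|b t| - b t) / 2.

Let bp0 t : 0 <= bp t.
Proof. by rewrite /bp; have := ler_norm (- b t); rewrite normrN; lra. Qed.

Let bm0 t : 0 <= bm t.
Proof. by rewrite /bm; have := ler_norm (b t); lra. Qed.

Let bpm t : bp t + bm t = `|b t|. Proof. by rewrite /bp /bm; lra. Qed.

Let bpk : (\esum_(t in Q) (bp t)%:E <= k%:E)%E.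
Proof.
apply: le_trans bk; apply: le_esum => t _.
by rewrite lee_fin -bpm lerDl.
Qed.

Let bmk : (\esum_(t in Q) (bm t)%:E <= k%:E)%E.
Proof.
apply: le_trans bk; apply: le_esum => t _.
by rewrite lee_fin -bpm lerDr.
Qed.

(* [jump1 - jump2] is the function equal to [b t] on [[lo t, hi t[] for [t] in
   [Q] and to zero elsewhere, written as a difference of increasing functions. *)
Definition jump1 s := jump_fun Q bp lo s + jump_fun Q bm hi s.
Definition jump2 s := jump_fun Q bm lo s + jump_fun Q bp hi s.

Lemma jump1_nd s t : (s <= t)%O -> jump1 s <= jump1 t.
Proof.
by move=> st; rewrite lerD ?(jump_fun_nd bp0 bpk)// (jump_fun_nd bm0 bmk).
Qed.

Lemma jump2_nd s t : (s <= t)%O -> jump2 s <= jump2 t.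
Proof.
by move=> st; rewrite lerD ?(jump_fun_nd bp0 bpk)// (jump_fun_nd bm0 bmk).
Qed.

Lemma jump1_rc : Defs.right_continuous jump1.
Proof.
apply: right_continuousD.
- exact: (jump_fun_rc bp0 bpk).
- exact: (jump_fun_rc bm0 bmk).
Qed.

Lemma jump2_rc : Defs.right_continuous jump2.
Proof.
apply: right_continuousD.
- exact: (jump_fun_rc bm0 bmk).
- exact: (jump_fun_rc bp0 bpk).
Qed.

Lemma jump1_ge0 s : 0 <= jump1 s.
Proof. by rewrite addr_ge0 ?jump_mass_ge0. Qed.

Lemma jump2_ge0 s : 0 <= jump2 s.
Proof. by rewrite addr_ge0 ?jump_mass_ge0. Qed.

(** Each [|b t|] counts once at [lo t] and once at [hi t], whence the factor 2. *)
Lemma jump12_le s : jump1 s + jump2 s <= 2 * k.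
Proof.
have bpmk : (\esum_(t in Q) (bp t + bm t)%:E <= k%:E)%E.
  by under eq_esum do rewrite bpm.
have := jump_mass_addl [set t | (lo t <= s)%O] bp0 bm0 bpmk.
have := jump_mass_addl [set t | (hi t <= s)%O] bp0 bm0 bpmk.
rewrite /jump1 /jump2 /jump_fun; lra.
Qed.

Lemma jump12E s : jump1 s - jump2 s = if (s < hi (phi s))%O then b (phi s) else 0.
Proof.
have := jump_fun_lo_hi s bp0 bpk; have := jump_fun_lo_hi s bm0 bmk.
rewrite /jump1 /jump2.
case: ifP => _; last by lra.
have -> : b (phi s) = bp (phi s) - bm (phi s) by rewrite /bp /bm; lra.
lra.
Qed.

Definition lift s := F (phi s) - (jump1 s - jump2 s).

Lemma lift_hi t : lift (hi t) = F t.
Proof. by rewrite /lift jump12E (phi_hi mphi hiE sphi) ltxx subr0. Qed.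

Lemma lift_lt s : (s < hi (phi s))%O -> lift s = F (phi s) - b (phi s).
Proof. by move=> sh; rewrite /lift jump12E sh. Qed.

(** The subtracted term is the jump mass up to [x]. In [bvnorm_lift] it pays for the change of the
    value at the minimum, so that the total cost stays [2 * k]. *)
Lemma varsum_lift (V : R) x s :
  (forall s', sorted <%O s' -> varsum F s' <= V) -> path <%O x s ->
  varsum lift (x :: s) <= V + 2 * k - (jump1 x + jump2 x).
Proof.
move=> FV xs; have [s' [ps' E]] := varsum_comp mphi F xs.
have := FV (phi x :: s') ps'; rewrite -E => H.
have := varsumB (fun z => F (phi z)) (fun z => jump1 z - jump2 z) (x :: s).
have := varsumB jump1 jump2 (x :: s).
rewrite (varsum_nd jump1_nd xs) (varsum_nd jump2_nd xs).
have := jump12_le (last x s); rewrite /lift; lra.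
Qed.

Lemma lift_bound (V : R) : (forall t, `|F t| <= V) ->
  (forall s, sorted <%O s -> varsum F s <= V) ->
  (forall s, `|lift s| <= V + 2 * k) /\
  (forall s, sorted <%O s -> varsum lift s <= V + 2 * k).
Proof.
move=> FV VV; split=> [s|[|x s] xs].
- have := FV (phi s); have := jump1_ge0 s; have := jump2_ge0 s.
  have := jump12_le s; rewrite /lift !ler_norml; lra.
- have := le_trans (normr_ge0 _) (FV point); have := jump12_le (lo point).
  have := jump1_ge0 (lo point); have := jump2_ge0 (lo point).
  by rewrite /varsum big_nil; lra.
- have := varsum_lift VV xs; have := jump1_ge0 x; have := jump2_ge0 x; lra.
Qed.

Lemma bvnorm_lift : (Defs.variation F < +oo)%E ->
  (bvnorm lift <= bvnorm F + (2 * k)%:E)%E.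
Proof.
move=> VF; apply: ge_ereal_sup => _ [m mP <-].
have V0 : (0 <= Defs.variation F)%E.
  by apply: ereal_sup_ubound; exists [::] => //=; rewrite /varsum big_nil.
have /fineK VE : Defs.variation F \is a fin_num by rewrite ge0_fin_numE.
set v := fine _ in VE.
have Fv s : sorted <%O s -> varsum F s <= v.
  move=> ss; rewrite -lee_fin VE; apply: ereal_sup_ubound; by exists s.
apply: le_trans (_ : ((`|F (phi m)|)%:E + Defs.variation F + (2 * k)%:E <= _)%E); last first.
  apply: leeD => //; apply: ereal_sup_ubound; exists (phi m) => //= t.
  by have [s <-] := sphi t; exact: mphi.
have HG : (Defs.variation lift <= (v + 2 * k - (jump1 m + jump2 m))%:E)%E.
  apply: ge_ereal_sup => _ [s ss <-]; rewrite lee_fin.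
  case: s ss => [_|x s xs].
    rewrite /varsum big_nil; have := jump12_le m.
    by have := Fv [::] isT; rewrite /varsum big_nil; lra.
  apply: le_trans (varsum_lift Fv xs) _.
  have := jump1_nd (mP x); have := jump2_nd (mP x); lra.
apply: le_trans (leeD (lexx _) HG) _.
rewrite -VE -!EFinD lee_fin.
have := ler_normB (F (phi m)) (jump1 m - jump2 m); rewrite -/(lift m).
have := jump1_ge0 m; have := jump2_ge0 m.
have : `|jump1 m - jump2 m| <= jump1 m + jump2 m.
  by have := jump1_ge0 m; have := jump2_ge0 m; rewrite ler_norml; lra.
lra.
Qed.

(** As [jump1 - jump2] is subtracted, [jump2] joins the distribution of [nu1] and [jump1] that of
    [nu2]; both sums are nonnegative, increasing and right-continuous. *)
Lemma lift_measures (nu1 nu2 : {finite_measure set (Borel L) -> \bar R}) :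
  regular_measure nu1 -> regular_measure nu2 -> associated F nu1 nu2 ->
  Defs.right_continuous lift /\
  exists mu1 mu2 : {finite_measure set (Borel K) -> \bar R},
    [/\ regular_measure mu1, regular_measure mu2 & associated lift mu1 mu2].
Proof.
move=> r1 r2 aF.
pose D (nu : {finite_measure set (Borel L) -> \bar R}) s :=
  fine (nu [set t | (t <= phi s)%O]).
have D0 nu s : 0 <= D nu s by rewrite fine_ge0.
have Dnd nu s t : (s <= t)%O -> D nu s <= D nu t.
  move=> st; apply: fine_le; rewrite ?fin_num_measure//; do ?exact: lray_Borel.
  apply: le_measure; rewrite ?inE; do ?exact: lray_Borel.
  by move=> z /= /le_trans; apply; exact: mphi.
have rcD1 := right_continuousD (right_continuous_distribution cphi mphi r1) jump2_rc.
have rcD2 := right_continuousD (right_continuous_distribution cphi mphi r2) jump1_rc.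
have liftE s : lift s = (D nu1 s + jump2 s) - (D nu2 s + jump1 s).
  by rewrite /lift aF /D; lra.
split.
  rewrite (funext liftE); apply: right_continuousD => //.
  exact: right_continuousN.
have [||mu1 [rm1 E1]] := regular_measure_of_distribution cK _ _ rcD1.
- by move=> t; rewrite addr_ge0 ?jump2_ge0// D0.
- by move=> s t st; rewrite lerD ?jump2_nd//; exact: Dnd.
have [||mu2 [rm2 E2]] := regular_measure_of_distribution cK _ _ rcD2.
- by move=> t; rewrite addr_ge0 ?jump1_ge0// D0.
- by move=> s t st; rewrite lerD ?jump1_nd//; exact: Dnd.
by exists mu1, mu2; split => // t; rewrite E1 E2 liftE.
Qed.

End one_function.

Lemma ray_phi t : (fun x => ray t (phi x) : R) = ray (hi t).
Proof. by apply/funext => x; rewrite /ray hiE. Qed.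

Lemma eq_of_dist_le (a b B : R) : 0 <= B ->
  (forall e, 0 < e -> `|a - b| <= e * B) -> a = b.
Proof.
move=> B0 H; apply/eqP; rewrite -subr_eq0 -normr_le0.
apply: (ler_addgt0M B0) => e e0; rewrite add0r; exact: H.
Qed.

(** * Integrals against the measures of the extension *)

Section sintegral_lift.
Variables (F : L -> R) (G : K -> R).
Variables (nu1 nu2 : {finite_measure set (Borel L) -> \bar R}).
Variables (mu1 mu2 : {finite_measure set (Borel K) -> \bar R}).
Hypotheses (aF : associated F nu1 nu2) (aG : associated G mu1 mu2).
Hypothesis FG : forall t, F t = G (hi t).

(** Only distribution functions link the two pairs of measures. The integrals agree on rays, because
    [ray t] composed with [phi] is [ray (hi t)] and [G (hi t) = F t]; step functions and uniform
    approximation do the rest. *)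
Lemma sintegral_comp (h : L -> R) : continuous h ->
  Defs.sintegral mu1 mu2 (fun x => h (phi x)) = Defs.sintegral nu1 nu2 h.
Proof.
move=> ch.
have [m mP] := compact_line_min cL; have [M MP] := compact_line_max cL.
have mK := total_mass_ge0 mu1 mu2 setT; have mL := total_mass_ge0 nu1 nu2 setT.
apply: (@eq_of_dist_le _ _ (total_mass mu1 mu2 setT + total_mass nu1 nu2 setT)).
  by rewrite addr_ge0.
move=> e e0; have [s [ps lq]] := slow_path cL ch e0 (mP M).
pose st x := h m * ray m x + step_fun h m s x.
have ps' := path_slow_lt ps.
have hst x : `|h x - st x| <= e.
  rewrite /st; have [xm|mx] := leP x m.
    have -> : x = m by apply/eqP; rewrite eq_le xm mP.
    by rewrite ray_le// (step_fun_le _ ps')// mulr1 addr0 subrr normr0 ltW.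
  by rewrite ray_gt// mulr0 add0r (step_fun_approx _ ps)// ?lq ?MP// ltW.
have bray t : bounded_borel (fun x => ray t (phi x) : R).
  by rewrite ray_phi; exact: bounded_borel_ray.
have bstep u s1 : bounded_borel (fun x => step_fun h u s1 (phi x)).
  elim: s1 u => [|y s1 IH] u /=; first exact: bounded_borel_cst.
  by apply: bounded_borelD => //; apply: bounded_borelZ; exact: bounded_borelB.
have bst : bounded_borel (fun x => st (phi x)).
  by apply: bounded_borelD => //; exact: bounded_borelZ.
have Jray t : Defs.sintegral mu1 mu2 (fun x => ray t (phi x)) = F t.
  by rewrite ray_phi (sintegral_ray_assoc aG) FG.
have Jstep u s1 : Defs.sintegral mu1 mu2 (fun x => step_fun h u s1 (phi x)) =
    Defs.sintegral nu1 nu2 (step_fun h u s1).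
  rewrite (sintegral_step aF); elim: s1 u => [|y s1 IH] u /=.
    exact: sintegral0.
  rewrite sintegralD ?sintegralZ ?sintegralB ?Jray ?IH//; first exact: bounded_borelB.
  by apply: bounded_borelZ; exact: bounded_borelB.
have Jst : Defs.sintegral mu1 mu2 (fun x => st (phi x)) = Defs.sintegral nu1 nu2 st.
  rewrite /st sintegralD//; last exact: bounded_borelZ.
  rewrite Jstep sintegralZ// Jray.
  rewrite sintegralD; [| |exact: bounded_borel_step]; last first.
    by apply: bounded_borelZ; exact: bounded_borel_ray.
  rewrite sintegralZ; last exact: bounded_borel_ray.
  by rewrite (sintegral_ray_assoc aF).
have chp : continuous (fun x => h (phi x)).
  by move=> x; apply: continuous_comp; [exact: cphi|exact: ch].
have := sintegral_dist mu1 mu2 (bounded_borel_continuous cK chp) bst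
  (fun x => hst (phi x)).
have bstL : bounded_borel st.
  apply: bounded_borelD; last exact: bounded_borel_step.
  by apply: bounded_borelZ; exact: bounded_borel_ray.
have := sintegral_dist nu1 nu2 (bounded_borel_continuous cL ch) bstL hst.
rewrite Jst !ler_norml; lra.
Qed.

(** Only the increment ending at [v] can be nonzero. *)
Lemma rs_sum_const (w : K -> R) (c : R) u v s : path <%O u s -> last u s = v ->
  (u < v)%O -> (forall x, (u <= x)%O -> (x < v)%O -> G x = c) ->
  rs_sum w G u s = w v * (G v - c).
Proof.
elim: s u => [|y s IH] u /=; first by move=> _ ->; rewrite ltxx.
move=> /andP[uy ys] lv uv Gc.
have Gu := Gc u (lexx u) uv.
have yv : (y <= v)%O by rewrite -lv; exact: path_lt_last.
move: yv; rewrite le_eqVlt => /predU1P[yv|yv].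
  case: s ys lv {IH} => [|z s] /=; first by rewrite addr0 Gu yv.
  move=> /andP[yz zs] lv.
  by have := path_lt_last zs (lexx z); rewrite lv leNgt -yv yz.
rewrite (IH y ys lv yv); last first.
  by move=> x yx xv; apply: Gc => //; exact: le_trans (ltW uy) yx.
by rewrite Gu (Gc y (ltW uy) yv) subrr mulr0 add0r.
Qed.

(** [w] is the indicator of []v, M]] plus a part on []u, v]], whose Riemann-Stieltjes sums reduce to
    [G v - c] because [w v = 1]. *)
Lemma sintegral_gap (w : K -> R) (c : R) (u v M : K) : (forall x, (x <= M)%O) ->
  continuous w -> (u < v)%O ->
  (forall x, (x <= u)%O -> w x = 0) -> (forall x, (v <= x)%O -> w x = 1) ->
  (forall x, (u <= x)%O -> (x < v)%O -> G x = c) ->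
  Defs.sintegral mu1 mu2 w = G M - c.
Proof.
move=> MP cw uv w0 w1 Gc.
apply: (@eq_of_dist_le _ _ (total_mass mu1 mu2 setT)); first exact: total_mass_ge0.
move=> e e0; have [s [ps lv Hs]] := sintegral_rs cK aG cw e0 (ltW uv).
have wE : w = (fun x => (ray M x - ray v x) + w x * (ray v x - ray u x)).
  apply/funext => x; rewrite (ray_le (MP x)).
  have [xu|ux] := leP x u; first by rewrite w0// ray_le ?(le_trans xu (ltW uv))//; lra.
  rewrite (ray_gt ux); have [xv|vx] := leP x v; first by rewrite ray_le//; lra.
  by rewrite ray_gt// w1 ?(ltW vx)//; lra.
have bB (x y : K) : bounded_borel (fun z => ray x z - ray y z : R).
  by apply: bounded_borelB; exact: bounded_borel_ray.
rewrite {1}wE sintegralD//; last first.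
  by apply: bounded_borelM => //; exact: bounded_borel_continuous.
rewrite sintegralB; [|exact: bounded_borel_ray..].
rewrite !(sintegral_ray_assoc aG).
move: Hs; rewrite (rs_sum_const w ps lv uv Gc) w1// mul1r.
set X := Defs.sintegral _ _ _.
by congr (`| _ | <= _); lra.
Qed.

End sintegral_lift.

Lemma c0l1_bounded_extension (I : Type) (F : I -> L -> R) (k : I -> R) :
  wstar_null F -> (exists M : R, forall i, k i <= M) ->
  c0l1_bounded Q F k ->
  exists G : I -> K -> R, wstar_null G /\
    (forall i, pushes phi (G i) (F i)) /\
    (forall i, (bvnorm (G i) <= bvnorm (F i) + (2 * k i)%:E)%E).
Proof.
move=> wF [C kC] [a [b [Fab [a0 [_ bk]]]]].
have [B HB] := wstar_null_bounded cL wF.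
case: wF => NF [nu1 [nu2 [Hnu nullF]]].
pose G i := lift (F i) (b i).
have /choice[mu Hmu] i : exists mu : {finite_measure set (Borel K) -> \bar R} *
    {finite_measure set (Borel K) -> \bar R},
    [/\ Defs.right_continuous (G i), regular_measure mu.1, regular_measure mu.2 &
        associated (G i) mu.1 mu.2].
  have [r1 [r2 aF]] := Hnu i.
  have [rc [mu1 [mu2 [rm1 rm2 aG]]]] := lift_measures (bk i) r1 r2 aF.
  by exists (mu1, mu2).
have GH i t : F i t = G i (hi t) by rewrite /G (lift_hi _ (bk i)).
have GB i : (forall s, `|G i s| <= B + 2 * C) /\
    (forall s, sorted <%O s -> varsum (G i) s <= B + 2 * C).
  have [FB VB] := HB i; have [h1 h2] := lift_bound (bk i) FB VB.
  have := kC i; split=> [s|s ss]; first by have := h1 s; rewrite /G; lra.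
  by have := h2 s ss; rewrite /G; lra.
exists G; split; last first.
  split; first by move=> i; apply/(pushes_hi mphi hiE sphi).
  by move=> i; apply: bvnorm_lift (bk i) _; have [] := NF i.
split.
  move=> i; have [rc _ _ _] := Hmu i; split => //.
  apply: le_lt_trans (_ : (B + 2 * C)%:E < +oo)%E; last by rewrite ltry.
  apply: ge_ereal_sup => _ [s ss <-]; rewrite lee_fin.
  by have [_] := GB i; apply.
exists (fun i => (mu i).1), (fun i => (mu i).2); split.
  by move=> i; have [_ ? ? ?] := Hmu i.
have [m mP] := compact_line_min cK; have [M MP] := compact_line_max cK.
pose J i := Defs.sintegral (mu i).1 (mu i).2.
have aG i : associated (G i) (mu i).1 (mu i).2 by have [] := Hmu i.
have JD i (f g : K -> R) : continuous f -> continuous g ->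
    J i (fun x => f x + g x) = J i f + J i g.
  by move=> cf cg; apply: sintegralD; exact: bounded_borel_continuous.
have JZ i (c : R) (f : K -> R) : continuous f -> J i (fun x => c * f x) = c * J i f.
  by move=> cf; apply: sintegralZ; exact: bounded_borel_continuous.
have Jcomp i (h : L -> R) : continuous h ->
    J i (fun x => h (phi x)) = Defs.sintegral (nu1 i) (nu2 i) h.
  move=> ch; apply: sintegral_comp ch; [|exact: aG|exact: GH].
  by have [_ []] := Hnu i.
have cL1 : continuous ((fun=> 1) : L -> R) by exact: cst_continuous.
have cK1 : continuous ((fun=> 1) : K -> R) by exact: cst_continuous.
(* The integral of 1, which is [G i M], equals that of 1 against the measure of [F i]. *)
have J1 : c0lim (fun i => J i (fun=> 1)).
  by under eq_fun => i do rewrite (Jcomp i _ cL1); exact: nullF.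
have GM : c0lim (fun i => G i M).
  move: J1; congr c0lim; apply/funext => i.
  rewrite -(sintegral_ray_assoc (aG i)); congr Defs.sintegral.
  by apply/funext => x; rewrite ray_le.
have /choice[w' Hw'] (uv : K * K) : exists w : K -> R, (uv.1 < uv.2)%O ->
    [/\ continuous w, forall x, 0 <= w x <= 1,
        forall x, (x <= uv.1)%O -> w x = 0 & forall x, (uv.2 <= x)%O -> w x = 1] /\
    c0lim (fun i => J i w).
  case: uv => u v /=.
  have [uv|] := boolP (u < v)%O; last by exists (fun=> 0).
  have := mphi (ltW uv); rewrite le_eqVlt => /predU1P[puv|puv]; last first.
    have [h [ch h01 h0 h1]] := compact_line_urysohn cL R puv.
    exists (fun x => h (phi x)) => _; split; first split => //.
    + by move=> x; apply: continuous_comp; [exact: cphi|exact: ch].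
    + by move=> x xu; apply: h0; exact: mphi.
    + by move=> x vx; apply: h1; exact: mphi.
    by under eq_fun => i do rewrite (Jcomp i _ ch); exact: nullF.
  have [w [cw w01 w0 w1]] := compact_line_urysohn cK R uv.
  exists w => _; split => //.
  (* Here [u] and [v] share a fiber, so [[u, v[] lies in [[lo (phi u), hi (phi u)[], where [G i] is
     constantly [a i (phi u)]. *)
  have vh : (v <= hi (phi u))%O by rewrite hiE puv.
  have Qu : Q (phi u).
    apply/(QsetP mphi loE hiE sphi); apply: le_lt_trans (lt_le_trans uv vh).
    by rewrite loE.
  have Jw i : J i w = G i M + -1 * a i (phi u).
    rewrite mulN1r; apply: (sintegral_gap (aG i) MP cw uv w0 w1) => x ux xv.
    have pxu : phi x = phi u.
      by apply/eqP; rewrite eq_le (mphi ux) andbT puv; apply: mphi; exact: ltW.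
    rewrite /G (lift_lt _ (bk i)) pxu; last exact: lt_le_trans xv vh.
    by rewrite Fab// addrK.
  rewrite (funext Jw); apply: c0limD => //; apply: c0limZ; exact: a0.
pose w u v := w' (u, v).
have Hw u v : (u < v)%O -> _ := Hw' (u, v).
have w01 u v : (u < v)%O ->
  [/\ continuous (w u v), forall x, 0 <= w u v x <= 1,
      forall x, (x <= u)%O -> w u v x = 0 & forall x, (v <= x)%O -> w u v x = 1].
  by move=> /Hw[].
have Jw u v : (u < v)%O -> c0lim (fun i => J i (w u v)) by move=> /Hw[].
move=> f cf; apply: c0lim_approx => e e0.
(* A common bound for the BV norms of the [G i]: one summand for the value at [m], one for the
   variation. *)
pose N := B + 2 * C + (B + 2 * C).
(* [I] may be empty, and [N >= 0] is read off an index. *)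
have [[i0 _]|nI] := pselect (exists i : I, True); last first.
  exists (fun=> 0); split => [e' e'0|i]; last by case: nI; exists i.
  by rewrite (_ : mkset _ = set0)// -subset0 => i; case: nI; exists i.
have N0 : 0 <= N.
  have [H _] := GB i0; have := le_trans (normr_ge0 _) (H m); rewrite /N; lra.
have d0 : 0 < e / (N + 1) by rewrite divr_gt0//; lra.
have [s [ps ls]] := slow_path cK cf d0 (mP M).
have ps' := path_slow_lt ps.
have ci := continuous_interpolation w01 (f := f) ps'.
pose g x := f m * 1 + interpolation w f m s x.
have cg : continuous g by apply: continuousDr => //; exact: continuousZr.
exists (fun i => J i g); split.
  rewrite (_ : (fun i => _) = (fun i => f m * J i (fun=> 1) +
      J i (interpolation w f m s))).
    apply: c0limD; first exact: c0limZ.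
    exact: c0lim_interpolation.
  by apply/funext => i; rewrite JD ?JZ//; exact: continuousZr.
move=> i; rewrite -/(J i f).
have -> : J i f - J i g = J i (fun x => f x + -1 * g x).
  by rewrite JD ?JZ ?mulN1r//; exact: continuousZr.
have [GBi VBi] := GB i.
apply: le_trans (_ : e / (N + 1) * (`|G i m| + (B + 2 * C)) <= _).
  apply: (sintegral_le_bv cK (aG i)) => //.
    by apply: continuousDr => //; exact: continuousZr.
  move=> x; have := interpolation_approx w01 (ltW d0) ps (mP x).
  rewrite ls => /(_ (MP x)); rewrite /g.
  by congr (`| _ | <= _); lra.
apply: le_trans (_ : e / (N + 1) * N <= _).
  by rewrite ler_wpM2l ?(ltW d0)// /N lerD2r.
rewrite mulrAC ler_pdivrMr; last by lra.
by rewrite ler_wpM2l ?(ltW e0)//; lra.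
Qed.

End lift.

Theorem theorem2p7 (R : realType) (dK dL : Order.disp_t)
  (K : pointedOrderTopologicalType dK) (L : pointedOrderTopologicalType dL)
  (phi : K -> L) (I : Type) (F : I -> L -> R) :
  compact_line K -> compact_line L ->
  continuous phi -> {homo phi : x y / (x <= y)%O} ->
  (forall t : L, exists s : K, phi s = t) ->
  wstar_null F ->
  (extends_through phi F <-> c0l1 (Qset phi) F) /\
  (forall k : I -> R, (forall i, 0 <= k i) -> (exists M : R, forall i, k i <= M) ->
     c0l1_bounded (Qset phi) F k ->
     exists G : I -> K -> R, wstar_null G /\
       (forall i, pushes phi (G i) (F i)) /\
       (forall i, (bvnorm (G i) <= bvnorm (F i) + (2 * k i)%:E)%E)).
Proof.
move=> [cK _] [cL _] cphi mphi sphi wF.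
have [lo [hi [loE hiE]]] := fiber_ends cK cphi mphi sphi.
have ext := c0l1_bounded_extension cK cL cphi mphi sphi loE hiE wF.
split; last by move=> k _ bk cF; exact: ext bk cF.
split; first exact: extends_through_c0l1.
move=> [a [b [Fab [a0 [M bM]]]]].
(* A uniform bound [M] on the sums is a bound by the constant family [M]. *)
have [||G [wG [pG _]]] := ext (fun=> M); first by exists M.
  by exists a, b; split => //; split => //; split => //; exists M.
by exists G.
Qed.
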